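(* Let $f_0,f_2$ be positive integers. There exists a toric line arrangement $\mathcal{A}$ in $\mathbb{T}^2$ with exactly $f_0$ vertices and exactly $f_2$ chambers if and only if \[f_0\le f_2\le 2f_0.\] Moreover, for any toric line arrangement, $f_2=f_0$ holds if and only if $\mathcal{A}$ is simple, and $f_2=2f_0$ holds if and only if $\mathcal{A}$ is simplicial.
   Context: Let $\mathbb{T}^2=\mathbb{R}^2/\mathbb{Z}^2$ with quotient (covering) map $\pi:\mathbb{R}^2\to\mathbb{T}^2$. A toric line is the image $\pi(L)$ of a line $L=\{(x,y)\in\mathbb{R}^2: ax+by=c\}$ with $a,b\in\mathbb{Z}$ coprime and $c\in\mathbb{R}$; it is said to be of type $(a,b)$. A toric line arrangement is a finite set $\mathcal{A}=\{l_1,\dots,l_n\}$ of distinct toric lines which is essential, i.e. not all of its lines are of the same type (not all lines are parallel). The vertices of $\mathcal{A}$ are the points of $\mathbb{T}^2$ lying on at least two lines of $\mathcal{A}$; the edges are the connected components of $\bigcup_i l_i$ with the vertices removed; the chambers are the connected components of $\mathbb{T}^2\setminus\bigcup_i l_i$. We write $f_0,f_1,f_2$ for the numbers of vertices, edges and chambers. The degree of a vertex is the number of lines of $\mathcal{A}$ passing through it. $\mathcal{A}$ is simple if every vertex has degree $2$ (no three lines pass through a common point). A subset $C\subseteq\mathbb{T}^2$ is a toric $k$-gon if there is a $k$-gon $C_0\subset\mathbb{R}^2$ with $\pi(C_0)=C$ such that the restriction of $\pi$ to the interior of $C_0$ is a homeomorphism onto its image (each chamber of an essential arrangement is a toric $k$-gon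 for a unique $k\ge3$). $\mathcal{A}$ is simplicial if every chamber is a toric $3$-gon (triangle). *)

(* Defs.v *)
From Stdlib Require Import Reals ZArith List.
Open Scope R_scope.

(* Points of R^2.  Subsets of the torus T^2 = R^2/Z^2 are modelled as
   Z^2-invariant predicates on R^2 (i.e. by their preimage under pi). *)
Definition pt := (R * R)%type.

Definition shift (p : pt) (m n : Z) : pt := (fst p + IZR m, snd p + IZR n).

Definition torus_eq (p q : pt) : Prop := exists m n : Z, q = shift p m n.

Definition z2inv (S : pt -> Prop) : Prop :=
  forall p m n, S p <-> S (shift p m n).

Definition dist2 (p q : pt) : R :=
  (fst p - fst q) ^ 2 + (snd p - snd q) ^ 2.

Definition openR2 (S : pt -> Prop) : Prop :=
  forall p, S p -> exists eps, 0 < eps /\ forall q, dist2 p q < eps ^ 2 -> S q.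

Definition torus_open (S : pt -> Prop) : Prop := z2inv S /\ openR2 S.

Definition torus_connected (S : pt -> Prop) : Prop :=
  ~ exists U V : pt -> Prop,
      torus_open U /\ torus_open V /\
      (forall p, S p -> U p \/ V p) /\
      (exists p, S p /\ U p) /\ (exists p, S p /\ V p) /\
      (forall p, S p -> U p -> V p -> False).

Definition tline := (Z * Z * R)%type.

Definition tline_ok (l : tline) : Prop :=
  let '(a, b, _) := l in Z.gcd a b = 1%Z.

Definition on_affine (l : tline) (p : pt) : Prop :=
  let '(a, b, c) := l in IZR a * fst p + IZR b * snd p = c.

Definition on_tline (l : tline) (p : pt) : Prop :=
  exists q m n, on_affine l q /\ p = shift q m n.

Definition same_tline (l l' : tline) : Prop :=
  forall p, on_tline l p <-> on_tline l' p.

Definition all_same_type (A : list tline) : Prop :=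
  exists a b : Z, Z.gcd a b = 1%Z /\
    forall l, In l A -> exists c : R, same_tline l (a, b, c).

Definition arrangement (A : list tline) : Prop :=
  (forall l, In l A -> tline_ok l) /\
  (forall i j, (i < length A)%nat -> (j < length A)%nat -> i <> j ->
      ~ same_tline (nth i A (0%Z, 0%Z, 0)) (nth j A (0%Z, 0%Z, 0))) /\
  ~ all_same_type A.

Definition lineA (A : list tline) (i : nat) : tline := nth i A (0%Z, 0%Z, 0).

Definition vertex (A : list tline) (p : pt) : Prop :=
  exists i j, (i < length A)%nat /\ (j < length A)%nat /\ i <> j /\
    on_tline (lineA A i) p /\ on_tline (lineA A j) p.

Definition degree_is (A : list tline) (p : pt) (d : nat) : Prop :=
  exists idx : list nat, NoDup idx /\ length idx = d /\
    forall i, In i idx <-> ((i < length A)%nat /\ on_tline (lineA A i) p).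

Definition simple (A : list tline) : Prop :=
  forall p, vertex A p -> degree_is A p 2.

Definition compl (A : list tline) (p : pt) : Prop :=
  forall l, In l A -> ~ on_tline l p.

Definition same_chamber (A : list tline) (p q : pt) : Prop :=
  exists S : pt -> Prop, z2inv S /\ torus_connected S /\
    (forall x, S x -> compl A x) /\ S p /\ S q.

Definition chamber (A : list tline) (p : pt) (x : pt) : Prop :=
  compl A x /\ same_chamber A p x.

Definition card_classes (P : pt -> Prop) (E : pt -> pt -> Prop) (n : nat) : Prop :=
  exists l : list pt, length l = n /\ (forall x, In x l -> P x) /\
    (forall i j, (i < j)%nat -> (j < n)%nat -> ~ E (nth i l (0,0)) (nth j l (0,0))) /\
    (forall x, P x -> exists y, In y l /\ E x y).

Definition num_vertices (A : list tline) (n : nat) : Prop :=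
  card_classes (vertex A) torus_eq n.

Definition num_chambers (A : list tline) (n : nat) : Prop :=
  card_classes (compl A) (same_chamber A) n.

Definition open_triangle (P1 P2 P3 : pt) (x : pt) : Prop :=
  exists l1 l2 l3, 0 < l1 /\ 0 < l2 /\ 0 < l3 /\ l1 + l2 + l3 = 1 /\
    x = (l1 * fst P1 + l2 * fst P2 + l3 * fst P3,
         l1 * snd P1 + l2 * snd P2 + l3 * snd P3).

Definition noncollinear (P1 P2 P3 : pt) : Prop :=
  (fst P2 - fst P1) * (snd P3 - snd P1) - (snd P2 - snd P1) * (fst P3 - fst P1) <> 0.

(* C (subset of T^2) is a toric 3-gon: C = pi(T) for a triangle T such that
   pi restricted to the interior of T (= T, T open) is a homeomorphism onto
   its image (injective, with continuous inverse w.r.t. the torus metric;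
   continuity of pi itself is automatic). *)
Definition toric_triangle (C : pt -> Prop) : Prop :=
  exists P1 P2 P3, noncollinear P1 P2 P3 /\
    let T := open_triangle P1 P2 P3 in
    (forall x, C x <-> exists t, T t /\ torus_eq t x) /\
    (forall s t, T s -> T t -> torus_eq s t -> s = t) /\
    (forall s, T s -> forall eps, 0 < eps -> exists delta, 0 < delta /\
       forall t, T t -> (exists m n, dist2 s (shift t m n) < delta ^ 2) ->
         dist2 s t < eps ^ 2).

Definition simplicial (A : list tline) : Prop :=
  forall p, compl A p -> toric_triangle (chamber A p).

(* Main.v *)
From Stdlib Require Import Reals ZArith List Lra Lia Classical.
Require Import Defs.
Open Scope R_scope.

(** A chamber lifts to a bounded convex cell of R^2, cut out by one strip
    [k l < a x + b y - c < k l + 1] per line [l = (a, b, c)]. Fix a vector [h] parallel to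
    no line and measure heights by [q |-> cross h q].

    Sending a chamber to its unique highest vertex is onto the vertices, so
    [f0 <= f2]; a vertex of degree [d] is the highest vertex of exactly [d - 1] chambers,
    so equality holds iff all degrees are 2. Sending a pair (vertex, side) to the chamber
    seen from the vertex in the direction [h] or [- h] is onto the chambers, because every
    cell has a vertex other than its highest and lowest ones, so [f2 <= 2 f0]; it is
    injective iff every cell has only one such middle vertex, i.e. is a triangle.

    All pairs with [f0 <= f2 <= 2 f0] are realised by the lines [y = 0], [y = f0 x] and
    [x = j / f0] for [j < f2 - f0]. *)

(** The role of compactness is played by two facts: a cell has finitely many candidate vertices, and
    from any point of the closed cell one can walk to a vertex without losing height, for any linear
    height. As no wall is level for a generic [h], the highest point is unique. This uniqueness also
    shows that no nonzero integer translation preserves a cell, so cells embed in the torus and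
    counting may be done in R^2 modulo Z^2.

    A middle vertex sees its cell along [h] or [- h] because the level line through it meets the
    chord from the lowest to the highest vertex, and meets it elsewhere, a vertex being an extreme
    point.

    Vertices and chambers are given by lists of representatives, known only up to translation. The
    maps of the overview are therefore relations, total on one list and injective, and every
    inequality is a pigeonhole argument. Equality cases use a strict form: a target that duplicates
    another one can be deleted before counting. *)

Definition lval (l : tline) (p : pt) : R :=
  let '(a, b, c) := l in IZR a * fst p + IZR b * snd p - c.

Definition ldir (l : tline) (u : pt) : R :=
  let '(a, b, _) := l in IZR a * fst u + IZR b * snd u.

Definition ldet (l l' : tline) : Z :=
  let '(a, b, _) := l in let '(a', b', _) := l' in (a * b' - b * a')%Z.

Definition is_int (r : R) : Prop := exists z : Z, r = IZR z.

Definition vadd (p : pt) (t : R) (u : pt) : pt :=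
  (fst p + t * fst u, snd p + t * snd u).

Definition vsub (q p : pt) : pt := (fst q - fst p, snd q - snd p).

Definition vopp (u : pt) : pt := (- fst u, - snd u).

Definition cross (u w : pt) : R := fst u * snd w - snd u * fst w.

Lemma lval_vadd (l : tline) (p : pt) (t : R) (u : pt) :
  lval l (vadd p t u) = lval l p + t * ldir l u.
Proof. destruct l as [[a b] c]; simpl; ring. Qed.

Lemma ldir_vsub (l : tline) (q p : pt) : ldir l (vsub q p) = lval l q - lval l p.
Proof. destruct l as [[a b] c]; simpl; ring. Qed.

Lemma ldir_vopp (l : tline) (u : pt) : ldir l (vopp u) = - ldir l u.
Proof. destruct l as [[a b] c]; simpl; ring. Qed.

Lemma ldir_vadd (l : tline) (u : pt) (t : R) (w : pt) :
  ldir l (vadd u t w) = ldir l u + t * ldir l w.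
Proof. destruct l as [[a b] c]; simpl; ring. Qed.

Lemma lval_shift (l : tline) (p : pt) (m n : Z) :
  lval l (shift p m n) = lval l p + IZR (fst (fst l) * m + snd (fst l) * n).
Proof.
  destruct l as [[a b] c]; simpl. rewrite plus_IZR, !mult_IZR. ring.
Qed.

Lemma cross_vadd (h p : pt) (t : R) (u : pt) :
  cross h (vadd p t u) = cross h p + t * cross h u.
Proof. unfold cross, vadd; simpl; ring. Qed.

Lemma cross_vsub (h p q : pt) : cross h (vsub q p) = cross h q - cross h p.
Proof. unfold cross, vsub; simpl; ring. Qed.

Lemma cross_vopp (h p : pt) : cross (vopp h) p = - cross h p.
Proof. unfold cross, vopp; simpl; ring. Qed.

Lemma vadd_vsub (p q : pt) : vadd p 1 (vsub q p) = q.
Proof. destruct p, q; unfold vadd, vsub; simpl; f_equal; ring. Qed.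

Lemma vadd_vadd (p : pt) (s t : R) (u : pt) :
  vadd (vadd p s u) t u = vadd p (s + t) u.
Proof. unfold vadd; simpl; f_equal; ring. Qed.

Lemma vadd_0 (p u : pt) : vadd p 0 u = p.
Proof. destruct p; unfold vadd; simpl; f_equal; ring. Qed.

Lemma shift_shift (p : pt) (m n m' n' : Z) :
  shift (shift p m n) m' n' = shift p (m + m') (n + n').
Proof. unfold shift; simpl; rewrite !plus_IZR; f_equal; ring. Qed.

Lemma shift_0 (p : pt) : shift p 0 0 = p.
Proof. destruct p; unfold shift; simpl; f_equal; ring. Qed.

Lemma shift_opp (p : pt) (m n : Z) : shift (shift p m n) (- m) (- n) = p.
Proof. rewrite shift_shift, !Z.add_opp_diag_r; apply shift_0. Qed.

Lemma shift_inj (p q : pt) (m n : Z) : shift p m n = shift q m n -> p = q.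
Proof.
  intro H. rewrite <- (shift_opp p m n), <- (shift_opp q m n), H. reflexivity.
Qed.

Lemma shift_fixed (p : pt) (m n : Z) : shift p m n = p -> m = 0%Z /\ n = 0%Z.
Proof.
  destruct p as [x y]; unfold shift; simpl; intro H; injection H as H1 H2.
  split; apply eq_IZR; lra.
Qed.

Lemma vadd_shift (p : pt) (t : R) (u : pt) (m n : Z) :
  vadd (shift p m n) t u = shift (vadd p t u) m n.
Proof. unfold vadd, shift; simpl; f_equal; ring. Qed.

Lemma cross_shift (h p : pt) (m n : Z) :
  cross h (shift p m n) = cross h p + cross h (IZR m, IZR n).
Proof. unfold cross, shift; simpl; ring. Qed.

Lemma torus_eq_sym (p q : pt) : torus_eq p q -> torus_eq q p.
Proof.
  intros (m & n & ->). exists (- m)%Z, (- n)%Z. symmetry. apply shift_opp.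
Qed.

Lemma torus_eq_refl (p : pt) : torus_eq p p.
Proof. exists 0%Z, 0%Z. symmetry. apply shift_0. Qed.

Lemma ldir_both_zero (l1 l2 : tline) (u : pt) :
  ldet l1 l2 <> 0%Z -> ldir l1 u = 0 -> ldir l2 u = 0 -> u = (0, 0).
Proof.
  destruct l1 as [[a b] c], l2 as [[a' b'] c'], u as [x y]; simpl.
  intros D H1 H2.
  assert (D' : IZR a * IZR b' - IZR b * IZR a' <> 0).
  { rewrite <- !mult_IZR, <- minus_IZR. apply not_0_IZR. exact D. }
  assert (Hx : (IZR a * IZR b' - IZR b * IZR a') * x = 0).
  { replace (_ * x) with (IZR b' * (IZR a * x + IZR b * y)
      - IZR b * (IZR a' * x + IZR b' * y)) by ring. rewrite H1, H2; ring. }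
  assert (Hy : (IZR a * IZR b' - IZR b * IZR a') * y = 0).
  { replace (_ * y) with (IZR a * (IZR a' * x + IZR b' * y)
      - IZR a' * (IZR a * x + IZR b * y)) by ring. rewrite H1, H2; ring. }
  destruct (Rmult_integral _ _ Hx); [contradiction|].
  destruct (Rmult_integral _ _ Hy); [contradiction|]. subst; reflexivity.
Qed.

Lemma is_int_add (r : R) (z : Z) : is_int (r + IZR z) <-> is_int r.
Proof.
  split; intros [y H].
  - exists (y - z)%Z. rewrite minus_IZR; lra.
  - exists (y + z)%Z. rewrite plus_IZR; lra.
Qed.

(** By Bezout the values [a * m + b * n] exhaust the integers when [a], [b] are coprime, so the
    integer translates of the affine line are exactly the integer level sets of [lval l]. *)
Lemma on_tline_iff (l : tline) (p : pt) :
  tline_ok l -> (on_tline l p <-> is_int (lval l p)).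
Proof.
  destruct l as [[a b] c]; simpl; intro G. split.
  - intros (q & m & n & Hq & ->). exists (a * m + b * n)%Z.
    simpl in *. rewrite plus_IZR, !mult_IZR. lra.
  - intros [z Hz].
    destruct (Z.gcd_bezout a b 1 G) as (u & v & Huv).
    exists (shift p (- (z * u)) (- (z * v))), (z * u)%Z, (z * v)%Z.
    split.
    + simpl. rewrite !opp_IZR, !mult_IZR.
      assert (E : IZR u * IZR a + IZR v * IZR b = 1)
        by (rewrite <- !mult_IZR, <- plus_IZR, Huv; reflexivity).
      replace (IZR a * (fst p + - (IZR z * IZR u)) + IZR b * (snd p + - (IZR z * IZR v)))
        with (IZR a * fst p + IZR b * snd p - IZR z * (IZR u * IZR a + IZR v * IZR b))
        by ring.
      rewrite E. lra.
    + rewrite shift_shift, !Z.add_opp_diag_l, shift_0. reflexivity.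
Qed.

Lemma IZR_strict_between (k z : Z) : IZR k < IZR z -> IZR z < IZR k + 1 -> False.
Proof.
  rewrite <- plus_IZR. intros H1 H2. apply lt_IZR in H1, H2. lia.
Qed.

Lemma IZR_strip_unique (x : R) (k k' : Z) :
  IZR k < x < IZR k + 1 -> IZR k' < x < IZR k' + 1 -> k = k'.
Proof.
  intros H H'. assert (H1 : IZR k < IZR k' + 1) by lra.
  assert (H2 : IZR k' < IZR k + 1) by lra.
  rewrite <- plus_IZR in H1, H2. apply lt_IZR in H1, H2. lia.
Qed.

Lemma Int_part_bounds (x : R) : IZR (Int_part x) <= x < IZR (Int_part x) + 1.
Proof. destruct (base_Int_part x). lra. Qed.

Lemma Int_part_strict (x : R) :
  ~ is_int x -> IZR (Int_part x) < x < IZR (Int_part x) + 1.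
Proof.
  intro H. destruct (Int_part_bounds x) as [[H1|H1] H2]; [lra|].
  exfalso. apply H. exists (Int_part x). auto.
Qed.

(** * Cells and their vertices *)

(** The label of the cell of [p]. Labels are functions on all of [tline], so two labels are compared
    only on the members of [A]. *)
Definition floors (p : pt) (l : tline) : Z := Int_part (lval l p).

Definition closed_cell (A : list tline) (k : tline -> Z) (q : pt) : Prop :=
  forall l, In l A -> IZR (k l) <= lval l q <= IZR (k l) + 1.

Definition open_cell (A : list tline) (k : tline -> Z) (q : pt) : Prop :=
  forall l, In l A -> IZR (k l) < lval l q < IZR (k l) + 1.

Definition lines_ok (A : list tline) : Prop := forall l, In l A -> tline_ok l.

Definition spanning (A : list tline) : Prop :=
  exists l1 l2, In l1 A /\ In l2 A /\ ldet l1 l2 <> 0%Z.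

Definition crossing (A : list tline) (v : pt) : Prop :=
  exists l1 l2, In l1 A /\ In l2 A /\ ldet l1 l2 <> 0%Z /\
    is_int (lval l1 v) /\ is_int (lval l2 v).

Definition generic (A : list tline) (h : pt) : Prop :=
  forall l, In l A -> ldir l h <> 0.

Lemma compl_iff (A : list tline) (p : pt) :
  lines_ok A -> (compl A p <-> forall l, In l A -> ~ is_int (lval l p)).
Proof.
  intro ok. split; intros H l Hl C; apply (H l Hl); apply (on_tline_iff l p (ok l Hl)); auto.
Qed.

Lemma open_cell_floors (A : list tline) (p : pt) :
  lines_ok A -> compl A p -> open_cell A (floors p) p.
Proof.
  intros ok H l Hl. apply Int_part_strict. exact (proj1 (compl_iff A p ok) H l Hl).
Qed.

Lemma open_cell_compl (A : list tline) (k : tline -> Z) (p : pt) :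
  lines_ok A -> open_cell A k p -> compl A p.
Proof.
  intros ok H. apply compl_iff; auto. intros l Hl [z Hz].
  specialize (H l Hl). apply (IZR_strict_between (k l) z); lra.
Qed.

Lemma open_cell_unique (A : list tline) (k k' : tline -> Z) (p : pt) :
  open_cell A k p -> open_cell A k' p -> forall l, In l A -> k l = k' l.
Proof.
  intros H H' l Hl. apply (IZR_strip_unique (lval l p)); auto.
Qed.

Lemma open_closed_cell (A : list tline) (k : tline -> Z) (p : pt) :
  open_cell A k p -> closed_cell A k p.
Proof. intros H l Hl. specialize (H l Hl). lra. Qed.

Lemma open_cell_ext (A : list tline) (k k' : tline -> Z) (p : pt) :
  (forall l, In l A -> k l = k' l) -> open_cell A k p -> open_cell A k' p.
Proof. intros E H l Hl. rewrite <- E; auto. Qed.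

Lemma closed_cell_ext (A : list tline) (k k' : tline -> Z) (p : pt) :
  (forall l, In l A -> k l = k' l) -> closed_cell A k p -> closed_cell A k' p.
Proof. intros E H l Hl. rewrite <- E; auto. Qed.

(** The label of the cell translated by (m, n): an integer translation changes each [lval] by an
    integer. *)
Definition kshift (k : tline -> Z) (m n : Z) (l : tline) : Z :=
  (k l + (fst (fst l) * m + snd (fst l) * n))%Z.

Lemma open_cell_shift (A : list tline) (k : tline -> Z) (p : pt) (m n : Z) :
  open_cell A k p <-> open_cell A (kshift k m n) (shift p m n).
Proof.
  split; intros H l Hl; specialize (H l Hl); unfold kshift in *;
    rewrite lval_shift, plus_IZR in *; lra.
Qed.

Lemma closed_cell_shift (A : list tline) (k : tline -> Z) (p : pt) (m n : Z) :
  closed_cell A k p <-> closed_cell A (kshift k m n) (shift p m n).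
Proof.
  split; intros H l Hl; specialize (H l Hl); unfold kshift in *;
    rewrite lval_shift, plus_IZR in *; lra.
Qed.

Lemma convex_strict (x y lo hi t : R) :
  lo <= x <= hi -> lo < y < hi -> 0 < t <= 1 -> lo < x + t * (y - x) < hi.
Proof. intros. nra. Qed.

Lemma convex_weak (x y lo hi t : R) :
  lo <= x <= hi -> lo <= y <= hi -> 0 <= t <= 1 -> lo <= x + t * (y - x) <= hi.
Proof. intros. nra. Qed.

Lemma open_cell_segment (A : list tline) (k : tline -> Z) (q p : pt) (t : R) :
  closed_cell A k q -> open_cell A k p -> 0 < t <= 1 ->
  open_cell A k (vadd q t (vsub p q)).
Proof.
  intros Hq Hp Ht l Hl. rewrite lval_vadd, ldir_vsub.
  apply convex_strict; auto.
Qed.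

Lemma closed_cell_segment (A : list tline) (k : tline -> Z) (q p : pt) (t : R) :
  closed_cell A k q -> closed_cell A k p -> 0 <= t <= 1 ->
  closed_cell A k (vadd q t (vsub p q)).
Proof.
  intros Hq Hp Ht l Hl. rewrite lval_vadd, ldir_vsub.
  apply convex_weak; auto.
Qed.

(* Along a generic direction no wall can stay tight, so the interior of such a
   segment of the closed cell lies in the open cell. *)
Lemma open_cell_generic_segment (A : list tline) (k : tline -> Z) (q h : pt) (t s : R) :
  generic A h -> closed_cell A k q -> closed_cell A k (vadd q t h) ->
  0 < s < t -> open_cell A k (vadd q s h).
Proof.
  intros G Hq Ht Hs l Hl. specialize (G l Hl). specialize (Hq l Hl). specialize (Ht l Hl).
  rewrite lval_vadd in *. destruct (Rdichotomy _ _ G); nra.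
Qed.

Lemma closed_cell_limit (A : list tline) (k : tline -> Z) (v u : pt) (eps : R) :
  0 < eps -> (forall t, 0 < t < eps -> closed_cell A k (vadd v t u)) ->
  closed_cell A k v.
Proof.
  intros He H l Hl.
  assert (P : forall d, 0 < d -> IZR (k l) - d <= lval l v <= IZR (k l) + 1 + d).
  { intros d Hd.
    set (M := Rabs (ldir l u) + 1).
    assert (HM : 0 < M) by (unfold M; pose proof (Rabs_pos (ldir l u)); lra).
    set (t := Rmin (eps / 2) (d / M)).
    assert (Ht : 0 < t).
    { unfold t. apply Rmin_glb_lt; [lra|]. apply Rdiv_lt_0_compat; lra. }
    assert (Ht1 : t <= eps / 2) by apply Rmin_l.
    assert (Ht2 : t * M <= d).
    { replace d with (d / M * M) by (field; lra).
      apply Rmult_le_compat_r; [lra|apply Rmin_r]. }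
    specialize (H t ltac:(lra) l Hl). rewrite lval_vadd in H.
    assert (B : Rabs (t * ldir l u) <= d).
    { rewrite Rabs_mult, (Rabs_right t) by lra.
      unfold M in Ht2. nra. }
    pose proof (Rle_abs (t * ldir l u)). pose proof (Rle_abs (- (t * ldir l u))) as B'.
    rewrite Rabs_Ropp in B'. lra. }
  split; apply Rnot_lt_le; intro C.
  - specialize (P ((IZR (k l) - lval l v) / 2) ltac:(lra)). lra.
  - specialize (P ((lval l v - IZR (k l) - 1) / 2) ltac:(lra)). lra.
Qed.

Lemma spanning_direction (A : list tline) (u : pt) :
  spanning A -> u <> (0, 0) -> exists l, In l A /\ ldir l u <> 0.
Proof.
  intros (l1 & l2 & H1 & H2 & D) Hu.
  destruct (Req_dec (ldir l1 u) 0) as [E1|N1]; [|eauto].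
  destruct (Req_dec (ldir l2 u) 0) as [E2|N2]; [|eauto].
  exfalso. apply Hu. apply (ldir_both_zero l1 l2); auto.
Qed.

Lemma strip_exit (x b : R) (z : Z) :
  IZR z <= x <= IZR z + 1 -> b <> 0 ->
  exists t, 0 <= t /\ IZR z <= x + t * b <= IZR z + 1 /\ is_int (x + t * b).
Proof.
  intros H Hb. destruct (Rdichotomy _ _ Hb) as [N|P].
  - exists ((IZR z - x) / b). replace (x + (IZR z - x) / b * b) with (IZR z) by (field; lra).
    split; [|split; [lra|exists z; auto]].
    replace ((IZR z - x) / b) with ((x - IZR z) * / - b) by (field; lra).
    apply Rmult_le_pos; [lra|]. left; apply Rinv_0_lt_compat; lra.
  - exists ((IZR z + 1 - x) / b).
    replace (x + (IZR z + 1 - x) / b * b) with (IZR z + 1) by (field; lra).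
    split; [|split; [lra|exists (z + 1)%Z; rewrite plus_IZR; auto]].
    apply Rmult_le_pos; [lra|]. left; apply Rinv_0_lt_compat; lra.
Qed.

Lemma between_weak (x b lo hi t s : R) :
  lo <= x <= hi -> lo <= x + t * b <= hi -> 0 <= s <= t -> lo <= x + s * b <= hi.
Proof.
  intros H H' Hs. destruct (Rle_dec 0 b) as [L|L].
  - assert (0 <= s * b) by (apply Rmult_le_pos; lra).
    assert (s * b <= t * b) by (apply Rmult_le_compat_r; lra). lra.
  - assert (0 <= s * - b) by (apply Rmult_le_pos; lra).
    assert (s * - b <= t * - b) by (apply Rmult_le_compat_r; lra). lra.
Qed.

(* Walking from [q] in direction [u] until the first wall is reached. *)
Lemma cell_exit (A : list tline) (k : tline -> Z) (q u : pt) :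
  closed_cell A k q -> (exists l, In l A /\ ldir l u <> 0) ->
  exists t, 0 <= t /\ closed_cell A k (vadd q t u) /\
    exists l, In l A /\ ldir l u <> 0 /\ is_int (lval l (vadd q t u)).
Proof.
  induction A as [|l0 A IH]; intros Hq [l [Hl Nl]]; [destruct Hl|].
  assert (Hq0 : IZR (k l0) <= lval l0 q <= IZR (k l0) + 1) by (apply Hq; left; auto).
  assert (HqA : closed_cell A k q) by (intros l' Hl'; apply Hq; right; auto).
  destruct (classic (exists l, In l A /\ ldir l u <> 0)) as [E|NE].
  - destruct (IH HqA E) as (t & Ht & Hc & l' & Hl' & Nl' & Il').
    destruct (Req_dec (ldir l0 u) 0) as [Z0|N0].
    + exists t. split; auto. split.
      * intros l1 [<-|H1]; [rewrite lval_vadd, Z0; lra|auto].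
      * exists l'. split; [right|]; auto.
    + destruct (strip_exit _ _ _ Hq0 N0) as (t0 & Ht0 & Hs0 & I0).
      (* The earlier of the two exit times is taken; a strip that is left later is convex, so its
         bounds still hold there. *)
      destruct (Rle_dec t0 t) as [L|L].
      * exists t0. split; auto. split.
        -- intros l1 [<-|H1]; rewrite lval_vadd; auto.
           apply (between_weak _ _ _ _ t); auto. rewrite <- lval_vadd; auto.
        -- exists l0. split; [left; auto|]. split; auto. rewrite lval_vadd; auto.
      * exists t. split; auto. split.
        -- intros l1 [<-|H1]; auto. rewrite lval_vadd.
           apply (between_weak _ _ _ _ t0); auto. lra.
        -- exists l'. split; [right; auto|]. auto.
  - assert (Z : forall l', In l' A -> ldir l' u = 0).
    { intros l' Hl'. destruct (Req_dec (ldir l' u) 0); auto. exfalso; eauto. }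
    destruct Hl as [<-|Hl]; [|exfalso; eauto].
    destruct (strip_exit _ _ _ Hq0 Nl) as (t0 & Ht0 & Hs0 & I0).
    exists t0. split; auto. split.
    + intros l1 [<-|H1]; rewrite lval_vadd; auto. rewrite Z by auto.
      specialize (HqA l1 H1). lra.
    + exists l0. split; [left; auto|]. split; auto. rewrite lval_vadd; auto.
Qed.

(** Two walks that never lose height: one up to a first wall [l], then one along [l] up to a second
    wall, which is transverse to [l] since its value changes along [l]. As [h] is arbitrary, this
    serves as linear optimisation for any functional [cross h]. *)
Lemma cell_vertex_above (A : list tline) (k : tline -> Z) (h q : pt) :
  lines_ok A -> spanning A -> closed_cell A k q ->
  exists v, closed_cell A k v /\ crossing A v /\ cross h q <= cross h v.
Proof.
  intros ok sp Hq.
  assert (N1 : exists u, u <> (0, 0) /\ 0 <= cross h u).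
  { destruct (Rle_dec 0 (cross h (1, 0))) as [L|L].
    - exists (1, 0). split; auto. intro E; injection E; lra.
    - exists (-1, 0). split; [intro E; injection E; lra|].
      unfold cross in *; simpl in *; lra. }
  destruct N1 as (u & Nu & Cu).
  destruct (cell_exit A k q u Hq (spanning_direction A u sp Nu))
    as (t & Ht & Hc & l & Hl & Nl & Il).
  set (q1 := vadd q t u) in *.
  assert (N2 : exists w, w <> (0, 0) /\ 0 <= cross h w /\ ldir l w = 0).
  { assert (G := ok l Hl). destruct l as [[a b] c]; simpl in *.
    assert (NZ : ~ (a = 0 /\ b = 0)%Z) by (intros [-> ->]; discriminate).
    assert (NR : ~ (IZR a = 0 /\ IZR b = 0)).
    { intros [E1 E2]. apply eq_IZR in E1, E2. auto. }
    destruct (Rle_dec 0 (cross h (- IZR b, IZR a))) as [L|L].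
    - exists (- IZR b, IZR a). split; [|split; [auto|simpl; ring]].
      intro E; injection E; intros; apply NR; split; lra.
    - exists (IZR b, - IZR a). split; [|split; [|simpl; ring]].
      + intro E; injection E; intros; apply NR; split; lra.
      + unfold cross in *; simpl in *; lra. }
  destruct N2 as (w & Nw & Cw & Zw).
  destruct (cell_exit A k q1 w Hc (spanning_direction A w sp Nw))
    as (s & Hs & Hc2 & l' & Hl' & Nl' & Il').
  exists (vadd q1 s w). split; auto. split.
  - exists l, l'. repeat split; auto.
    (* If [l'] were parallel to [l], Bezout coefficients for [l] would write [ldir l' w] as a
       combination of [ldir l w] and the determinant, both zero. *)
    + intro D. apply Nl'.
      assert (G := ok l Hl).
      destruct l as [[a b] c], l' as [[a' b'] c']; simpl in *.
      destruct w as [x y]; simpl in *.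
      assert (D' : IZR a * IZR b' - IZR b * IZR a' = 0)
        by (rewrite <- !mult_IZR, <- minus_IZR, D; reflexivity).
      destruct (Z.gcd_bezout a b 1 G) as (e & f & Hef).
      assert (E : IZR e * IZR a + IZR f * IZR b = 1)
        by (rewrite <- !mult_IZR, <- plus_IZR, Hef; reflexivity).
      transitivity ((IZR e * IZR a + IZR f * IZR b) * (IZR a' * x + IZR b' * y));
        [rewrite E; ring|].
      replace ((IZR e * IZR a + IZR f * IZR b) * (IZR a' * x + IZR b' * y))
        with ((IZR e * IZR a' + IZR f * IZR b') * (IZR a * x + IZR b * y)
           + (IZR a * IZR b' - IZR b * IZR a') * (IZR e * y - IZR f * x)) by ring.
      rewrite Zw, D'. ring.
    + rewrite lval_vadd, Zw. replace (lval l q1 + s * 0) with (lval l q1) by ring. auto.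
  - rewrite cross_vadd. unfold q1. rewrite cross_vadd. nra.
Qed.

(** Cramer's rule for the point where [lval l1] is [r1] and [lval l2] is [r2]. *)
Definition cramer (l1 l2 : tline) (r1 r2 : R) : pt :=
  let '(a1, b1, c1) := l1 in let '(a2, b2, c2) := l2 in
  let d := IZR a1 * IZR b2 - IZR b1 * IZR a2 in
  ((IZR b2 * (r1 + c1) - IZR b1 * (r2 + c2)) / d,
   (IZR a1 * (r2 + c2) - IZR a2 * (r1 + c1)) / d).

Lemma cramer_eq (l1 l2 : tline) (v : pt) :
  ldet l1 l2 <> 0%Z -> v = cramer l1 l2 (lval l1 v) (lval l2 v).
Proof.
  intro D. destruct l1 as [[a b] c], l2 as [[a' b'] c'], v as [x y]; simpl in *.
  assert (D' : IZR a * IZR b' - IZR b * IZR a' <> 0).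
  { rewrite <- !mult_IZR, <- minus_IZR. apply not_0_IZR. exact D. }
  f_equal; field; auto.
Qed.

Lemma is_int_strip (x : R) (z : Z) :
  IZR z <= x <= IZR z + 1 -> is_int x -> x = IZR z \/ x = IZR z + 1.
Proof.
  intros [[H1|H1] [H2|H2]] [y ->]; auto; try lra.
  exfalso; apply (IZR_strict_between z y); auto.
Qed.

(** A vertex of the cell lies on two transverse walls, each at the lower or upper end of its strip,
    so it is a Cramer point for two lines of [A] and two offsets in {0, 1}. *)
Lemma cell_vertices_finite (A : list tline) (k : tline -> Z) :
  exists W, forall v, closed_cell A k v -> crossing A v -> In v W.
Proof.
  exists (map (fun x : (tline * tline) * (R * R) =>
     let '((l1, l2), (e1, e2)) := x in cramer l1 l2 (IZR (k l1) + e1) (IZR (k l2) + e2))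
     (list_prod (list_prod A A) (list_prod (0 :: 1 :: nil) (0 :: 1 :: nil)))).
  intros v Hv (l1 & l2 & H1 & H2 & D & I1 & I2).
  apply in_map_iff.
  assert (E : forall l, In l A -> is_int (lval l v) ->
     exists e, In e (0 :: 1 :: nil) /\ lval l v = IZR (k l) + e).
  { intros l Hl Il. destruct (is_int_strip _ _ (Hv l Hl) Il) as [E|E].
    - exists 0. split; [left; auto|lra].
    - exists 1. split; [right; left; auto|lra]. }
  destruct (E l1 H1 I1) as (e1 & He1 & E1). destruct (E l2 H2 I2) as (e2 & He2 & E2).
  exists ((l1, l2), (e1, e2)). split.
  - rewrite <- E1, <- E2. symmetry. apply cramer_eq; auto.
  - apply in_prod; apply in_prod; auto.
Qed.

Lemma list_argmax (W : list pt) (P : pt -> Prop) (f : pt -> R) :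
  (exists x, In x W /\ P x) ->
  exists x, In x W /\ P x /\ forall y, In y W -> P y -> f y <= f x.
Proof.
  induction W as [|w W IH]; intros [x [Hx Px]]; [destruct Hx|].
  destruct (classic (exists x, In x W /\ P x)) as [E|NE].
  - destruct (IH E) as (z & Hz & Pz & Mz).
    destruct (classic (P w /\ f z <= f w)) as [[Pw L]|N].
    + exists w. split; [left; auto|]. split; auto.
      intros y [<-|Hy] Py; [lra|]. specialize (Mz y Hy Py). lra.
    + exists z. split; [right; auto|]. split; auto.
      intros y [<-|Hy] Py; auto. destruct (Rle_dec (f w) (f z)); auto.
      exfalso; apply N; split; auto; lra.
  - destruct Hx as [<-|Hx]; [|exfalso; eauto].
    exists w. split; [left; auto|]. split; auto.
    intros y [<-|Hy] Py; [lra|exfalso; eauto].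
Qed.

Definition top (A : list tline) (h : pt) (k : tline -> Z) (v : pt) : Prop :=
  closed_cell A k v /\ crossing A v /\
  forall q, closed_cell A k q -> q <> v -> cross h q < cross h v.

(** * Germs of cells at a point *)

(* The strips containing [v + t u] for all small [t > 0]. *)
Definition germ_floors (v u : pt) (l : tline) : Z :=
  if Rlt_dec 0 (ldir l u) then Int_part (lval l v) else (- Int_part (- lval l v) - 1)%Z.

Definition germ (A : list tline) (k : tline -> Z) (v u : pt) : Prop :=
  exists eps, 0 < eps /\ forall t, 0 < t < eps -> open_cell A k (vadd v t u).

Lemma strip_stay_up (x d : R) (F : R) :
  x < F -> 0 < d -> exists eps, 0 < eps /\ forall t, 0 < t < eps -> x + t * d < F.
Proof.
  intros H Hd. exists ((F - x) / d). split.
  - apply Rdiv_lt_0_compat; lra.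
  - intros t Ht. assert (t * d < (F - x) / d * d) by (apply Rmult_lt_compat_r; lra).
    replace ((F - x) / d * d) with (F - x) in * by (field; lra). lra.
Qed.

(** A line missing [v] leaves room on both sides for small [t]; a line through [v] selects the strip
    on the side to which [u] points. *)
Lemma germ_exists (A : list tline) (v u : pt) :
  (forall l, In l A -> is_int (lval l v) -> ldir l u <> 0) ->
  germ A (germ_floors v u) v u.
Proof.
  induction A as [|l A IH]; intro H.
  - exists 1. split; [lra|]. intros t Ht l [].
  - destruct IH as (e1 & He1 & P1); [intros; apply H; auto; right; auto|].
    assert (P : exists e, 0 < e /\ forall t, 0 < t < e ->
       IZR (germ_floors v u l) < lval l v + t * ldir l u < IZR (germ_floors v u l) + 1).
    { unfold germ_floors. destruct (Rlt_dec 0 (ldir l u)) as [L|L].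
      - destruct (Int_part_bounds (lval l v)) as [B1 B2].
        destruct (strip_stay_up _ _ _ B2 L) as (e & He & Pe).
        exists e. split; auto. intros t Ht. specialize (Pe t Ht). nra.
      - destruct (Int_part_bounds (- lval l v)) as [B1 B2].
        rewrite minus_IZR, opp_IZR.
        destruct (Rlt_dec (ldir l u) 0) as [L'|L'].
        + destruct (strip_stay_up (- lval l v) (- ldir l u) _ B2 ltac:(lra)) as (e & He & Pe).
          exists e. split; auto. intros t Ht. specialize (Pe t Ht). nra.
        (* Here [u] is parallel to the line, which therefore misses [v]: the value is constant and
           strictly inside the strip. *)
        + assert (Z : ldir l u = 0) by lra. rewrite Z.
          exists 1. split; [lra|]. intros t Ht.
          destruct B1 as [B1|B1]; [lra|]. exfalso.
          apply (H l); auto; [left; auto|]. exists (- Int_part (- lval l v))%Z.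
          rewrite opp_IZR; lra. }
    destruct P as (e2 & He2 & P2). exists (Rmin e1 e2).
    split; [apply Rmin_glb_lt; auto|].
    intros t [Ht1 Ht2].
    assert (t < e1) by (eapply Rlt_le_trans; [exact Ht2|apply Rmin_l]).
    assert (t < e2) by (eapply Rlt_le_trans; [exact Ht2|apply Rmin_r]).
    intros l' [<-|Hl'].
    + rewrite lval_vadd. apply P2; lra.
    + apply P1; auto.
Qed.

Lemma germ_unique (A : list tline) (k k' : tline -> Z) (v u : pt) :
  germ A k v u -> germ A k' v u -> forall l, In l A -> k l = k' l.
Proof.
  intros (e & He & P) (e' & He' & P').
  set (t := Rmin e e' / 2).
  assert (Hm : 0 < Rmin e e') by (apply Rmin_glb_lt; auto).
  pose proof (Rmin_l e e'). pose proof (Rmin_r e e').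
  apply (open_cell_unique A k k' (vadd v t u)); [apply P|apply P']; unfold t; lra.
Qed.

Lemma germ_ext (A : list tline) (k k' : tline -> Z) (v u : pt) :
  (forall l, In l A -> k l = k' l) -> germ A k v u -> germ A k' v u.
Proof.
  intros E (e & He & P). exists e. split; auto. intros t Ht.
  apply (open_cell_ext A k); auto.
Qed.

Lemma germ_closed (A : list tline) (k : tline -> Z) (v u : pt) :
  germ A k v u -> closed_cell A k v.
Proof.
  intros (e & He & P). apply (closed_cell_limit A k v u e); auto.
  intros t Ht. apply open_closed_cell. auto.
Qed.

Lemma germ_point (A : list tline) (k : tline -> Z) (v u : pt) :
  germ A k v u -> exists t, 0 < t /\ open_cell A k (vadd v t u).
Proof. intros (e & He & P). exists (e / 2). split; [|apply P]; lra. Qed.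

Lemma germ_segment (A : list tline) (k : tline -> Z) (v p : pt) :
  closed_cell A k v -> open_cell A k p -> germ A k v (vsub p v).
Proof.
  intros Hv Hp. exists 1. split; [lra|]. intros t Ht. apply open_cell_segment; auto; lra.
Qed.

Lemma germ_not_tangent (A : list tline) (k : tline -> Z) (v u : pt) (l : tline) :
  germ A k v u -> In l A -> is_int (lval l v) -> ldir l u <> 0.
Proof.
  intros H Hl [z Hz] E. destruct (germ_point _ _ _ _ H) as (t & Ht & P).
  specialize (P l Hl). rewrite lval_vadd, E in P.
  apply (IZR_strict_between (k l) z); lra.
Qed.

(** A line through [v] bounds the cell, so the whole closed cell stays on the side of it into which
    [u] points. *)
Lemma germ_sign (A : list tline) (k : tline -> Z) (v u q : pt) (l : tline) :
  germ A k v u -> closed_cell A k q -> In l A -> is_int (lval l v) ->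
  0 <= ldir l u * (lval l q - lval l v).
Proof.
  intros H Hq Hl Iv. assert (Hv := germ_closed _ _ _ _ H l Hl).
  destruct (germ_point _ _ _ _ H) as (t & Ht & P).
  specialize (P l Hl). specialize (Hq l Hl). rewrite lval_vadd in P.
  destruct (is_int_strip _ _ Hv Iv) as [E|E]; rewrite E in *; nra.
Qed.

(** Near [v] the cell is decided by the lines through [v], and for these only the sign of [ldir]
    counts. *)
Lemma germ_transfer (A : list tline) (k : tline -> Z) (v u u' : pt) :
  germ A k v u ->
  (forall l, In l A -> is_int (lval l v) -> 0 < ldir l u * ldir l u') ->
  germ A k v u'.
Proof.
  intros H S. apply (germ_ext A (germ_floors v u')).
  2:{ apply germ_exists. intros l Hl Il E. specialize (S l Hl Il). rewrite E in S. lra. }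
  assert (G : germ A (germ_floors v u) v u).
  { apply germ_exists. intros l Hl Il. eapply germ_not_tangent; eauto. }
  intros l Hl. rewrite <- (germ_unique A _ _ v u G H l Hl).
  unfold germ_floors.
  destruct (classic (is_int (lval l v))) as [I|N].
  - specialize (S l Hl I).
    destruct (Rlt_dec 0 (ldir l u)), (Rlt_dec 0 (ldir l u')); auto; nra.
  (* For a non-integer value, the floor and the ceiling minus one coincide, so both branches of
     [germ_floors] agree. *)
  - assert (E : Int_part (lval l v) = (- Int_part (- lval l v) - 1)%Z).
    { apply (IZR_strip_unique (lval l v)); [apply Int_part_strict; auto|].
      assert (N' : ~ is_int (- lval l v)).
      { intros [z Hz]. apply N. exists (- z)%Z. rewrite opp_IZR; lra. }
      pose proof (Int_part_strict _ N'). rewrite minus_IZR, opp_IZR. lra. }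
    destruct (Rlt_dec 0 (ldir l u)), (Rlt_dec 0 (ldir l u')); auto.
Qed.

Lemma germ_interior (A : list tline) (k : tline -> Z) (p u : pt) :
  open_cell A k p -> germ A k p u.
Proof.
  intro Hp. assert (G : germ A (germ_floors p u) p u).
  { apply germ_exists. intros l Hl [z Hz]. exfalso. specialize (Hp l Hl).
    apply (IZR_strict_between (k l) z); lra. }
  apply (germ_ext A (germ_floors p u)); auto.
  intros l Hl. assert (C := germ_closed _ _ _ _ G l Hl). specialize (Hp l Hl).
  assert (H1 : IZR (germ_floors p u l) < IZR (k l) + 1) by lra.
  assert (H2 : IZR (k l) < IZR (germ_floors p u l) + 1) by lra.
  rewrite <- plus_IZR in H1, H2. apply lt_IZR in H1, H2. lia.
Qed.

(** * Heights and the highest point of a cell *)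

Lemma generic_vopp (A : list tline) (h : pt) : generic A h -> generic A (vopp h).
Proof. intros G l Hl. rewrite ldir_vopp. specialize (G l Hl). lra. Qed.

Lemma cross_colinear (h u : pt) :
  h <> (0, 0) -> cross h u = 0 -> exists t, u = (t * fst h, t * snd h).
Proof.
  destruct h as [a b], u as [x y]; unfold cross; simpl. intros N E.
  assert (Q : 0 < a * a + b * b).
  { destruct (Req_dec a 0) as [Za|Na], (Req_dec b 0) as [Zb|Nb]; subst.
    - exfalso; auto.
    - nra.
    - nra.
    - nra. }
  exists ((a * x + b * y) / (a * a + b * b)). f_equal.
  - transitivity (((a * a + b * b) * x + b * (a * y - b * x)) / (a * a + b * b)).
    + rewrite E. field. lra.
    + field; lra.
  - transitivity (((a * a + b * b) * y - a * (a * y - b * x)) / (a * a + b * b)).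
    + rewrite E. field. lra.
    + field; lra.
Qed.

Lemma same_height (h p q : pt) :
  h <> (0, 0) -> cross h p = cross h q -> exists t, q = vadd p t h.
Proof.
  intros N E. destruct (cross_colinear h (vsub q p) N) as [t Ht].
  { rewrite cross_vsub; lra. }
  exists t. rewrite <- (vadd_vsub p q), Ht. unfold vadd; simpl. f_equal; ring.
Qed.

Lemma generic_nonzero (A : list tline) (h : pt) :
  spanning A -> generic A h -> h <> (0, 0).
Proof.
  intros (l & _ & Hl & _) G E. apply (G l Hl). rewrite E.
  destruct l as [[a b] c]; simpl; ring.
Qed.

Lemma generic_segment_signed (A : list tline) (k : tline -> Z) (q h : pt) (t : R) :
  generic A h -> closed_cell A k q -> closed_cell A k (vadd q t h) -> t <> 0 ->
  germ A k q (if Rlt_dec 0 t then h else vopp h).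
Proof.
  intros G Hq Ht N. destruct (Rlt_dec 0 t) as [L|L].
  - exists t. split; auto. intros s Hs. apply (open_cell_generic_segment A k q h t); auto.
  - exists (- t). split; [lra|]. intros s Hs.
    apply (open_cell_generic_segment A k q (vopp h) (- t)); auto using generic_vopp.
    replace (vadd q (- t) (vopp h)) with (vadd q t h); auto.
    unfold vadd, vopp; simpl; f_equal; ring.
Qed.

Definition perp (h : pt) : pt := (- snd h, fst h).

Lemma cross_perp_pos (h : pt) : h <> (0, 0) -> 0 < cross h (perp h).
Proof.
  destruct h as [a b]; unfold cross, perp; simpl. intros N.
  destruct (Req_dec a 0) as [Za|Na], (Req_dec b 0) as [Zb|Nb]; subst; try nra.
  exfalso; auto.
Qed.

(** The maximum over the finitely many vertices is a maximum over the cell. A second point at this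
    height would lie on the level line through [v]; by genericity the segment between them runs in
    the open cell, from which one can still climb. *)
Lemma cell_top_exists (A : list tline) (h : pt) (k : tline -> Z) (q0 : pt) :
  lines_ok A -> spanning A -> generic A h -> closed_cell A k q0 ->
  exists v, top A h k v.
Proof.
  intros ok sp G H0. destruct (cell_vertices_finite A k) as [W HW].
  destruct (list_argmax W (fun v => closed_cell A k v /\ crossing A v) (cross h))
    as (v & Hv & [Cv Xv] & Mv).
  { destruct (cell_vertex_above A k h q0 ok sp H0) as (v & Cv & Xv & _).
    exists v. auto. }
  exists v. split; [auto|split; [auto|]].
  assert (M : forall q, closed_cell A k q -> cross h q <= cross h v).
  { intros q Hq. destruct (cell_vertex_above A k h q ok sp Hq) as (w & Cw & Xw & L).
    specialize (Mv w (HW w Cw Xw) (conj Cw Xw)). lra. }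
  intros q Hq N. destruct (M q Hq) as [L|E]; auto. exfalso.
  assert (N0 := generic_nonzero A h sp G).
  destruct (same_height h v q N0 (eq_sym E)) as [t Et].
  assert (Nt : t <> 0) by (intros ->; apply N; rewrite Et, vadd_0; auto).
  rewrite Et in Hq.
  assert (Ge := generic_segment_signed A k v h t G Cv Hq Nt).
  destruct (germ_point _ _ _ _ Ge) as (s & Hs & Os).
  destruct (germ_point _ _ _ _ (germ_interior A k _ (perp h) Os)) as (r & Hr & Or).
  specialize (M _ (open_closed_cell _ _ _ Or)).
  rewrite !cross_vadd in M. pose proof (cross_perp_pos h N0).
  assert (Z : cross h (if Rlt_dec 0 t then h else vopp h) = 0).
  { destruct (Rlt_dec 0 t); unfold cross, vopp; simpl; ring. }
  rewrite Z in M. nra.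
Qed.

Lemma top_unique (A : list tline) (h : pt) (k : tline -> Z) (v w : pt) :
  top A h k v -> top A h k w -> v = w.
Proof.
  intros (Cv & _ & Mv) (Cw & _ & Mw).
  destruct (classic (v = w)) as [E|N]; auto. exfalso.
  specialize (Mv w Cw (not_eq_sym N)). specialize (Mw v Cv N). lra.
Qed.

Lemma is_int_shift (l : tline) (p : pt) (m n : Z) :
  is_int (lval l (shift p m n)) <-> is_int (lval l p).
Proof. rewrite lval_shift. apply is_int_add. Qed.

Lemma crossing_shift (A : list tline) (p : pt) (m n : Z) :
  crossing A p -> crossing A (shift p m n).
Proof.
  intros (l1 & l2 & H1 & H2 & D & I1 & I2). exists l1, l2.
  rewrite !is_int_shift. auto.
Qed.

Lemma kshift_opp (k : tline -> Z) (m n : Z) (l : tline) :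
  kshift (kshift k (- m) (- n)) m n l = k l.
Proof. unfold kshift. lia. Qed.

Lemma closed_cell_unshift (A : list tline) (k : tline -> Z) (p : pt) (m n : Z) :
  closed_cell A (kshift k m n) p <-> closed_cell A k (shift p (- m) (- n)).
Proof.
  split; intros H l Hl; specialize (H l Hl); rewrite lval_shift in *;
    unfold kshift in *; rewrite !plus_IZR, ?mult_IZR, ?opp_IZR in *; lra.
Qed.

Lemma top_shift (A : list tline) (h : pt) (k : tline -> Z) (v : pt) (m n : Z) :
  top A h k v -> top A h (kshift k m n) (shift v m n).
Proof.
  intros (C & X & M). split; [apply closed_cell_shift; auto|].
  split; [apply crossing_shift; auto|].
  intros q Hq N. apply closed_cell_unshift in Hq.
  specialize (M _ Hq). rewrite !cross_shift in *.
  assert (E : cross h (IZR (- m), IZR (- n)) = - cross h (IZR m, IZR n))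
    by (rewrite !opp_IZR; unfold cross; simpl; ring).
  rewrite E in M.
  assert (shift q (- m) (- n) <> v).
  { intro Ev. apply N. rewrite <- Ev, shift_shift, !Z.add_opp_diag_l, shift_0. auto. }
  specialize (M H). lra.
Qed.

Lemma top_ext (A : list tline) (h : pt) (k k' : tline -> Z) (v : pt) :
  (forall l, In l A -> k l = k' l) -> top A h k v -> top A h k' v.
Proof.
  intros E (C & X & M). split; [apply (closed_cell_ext A k); auto|]. split; auto.
  intros q Hq. apply M. apply (closed_cell_ext A k'); auto.
  intros; symmetry; auto.
Qed.

(** A translation preserving the cell fixes its unique highest vertex, and a translation with a
    fixed point is trivial. *)
Lemma cell_no_period (A : list tline) (h : pt) (k : tline -> Z) (p : pt) (m n : Z) :
  lines_ok A -> spanning A -> generic A h ->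
  open_cell A k p -> open_cell A k (shift p m n) -> m = 0%Z /\ n = 0%Z.
Proof.
  intros ok sp G Hp Hs.
  destruct (cell_top_exists A h k p ok sp G (open_closed_cell _ _ _ Hp)) as [v Hv].
  apply (shift_fixed v). apply (top_unique A h k); auto.
  apply (top_ext A h (kshift k m n)); [|apply top_shift; auto].
  apply (open_cell_unique A _ _ (shift p m n)); auto. apply open_cell_shift; auto.
Qed.

(** * Chambers as orbits of cells *)

(** The supremum of the parameters satisfying [P] lies neither in [P], by openness to its right, nor
    in [Q], by openness to its left. *)
Lemma interval_connected (P Q : R -> Prop) :
  P 0 -> Q 1 -> (forall t, 0 <= t <= 1 -> P t \/ Q t) ->
  (forall t, 0 <= t <= 1 -> P t -> Q t -> False) ->
  (forall t, 0 <= t <= 1 -> P t -> exists e, 0 < e /\ forall s, Rabs (s - t) < e -> P s) ->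
  (forall t, 0 <= t <= 1 -> Q t -> exists e, 0 < e /\ forall s, Rabs (s - t) < e -> Q s) ->
  False.
Proof.
  intros P0 Q1 PQ D OP OQ.
  destruct (completeness (fun t => 0 <= t <= 1 /\ P t)) as [s [U L]].
  - exists 1. intros t [Ht _]. lra.
  - exists 0. split; auto; lra.
  - assert (Hs : 0 <= s <= 1).
    { split; [apply U; split; auto; lra|]. apply L. intros t [Ht _]. lra. }
    destruct (PQ s Hs) as [Ps|Qs].
    + destruct (Req_dec s 1) as [->|N]; [eapply D; eauto|].
      destruct (OP s Hs Ps) as (e & He & Pe).
      set (d := Rmin (e / 2) (1 - s)).
      assert (Hd : 0 < d) by (apply Rmin_glb_lt; lra).
      assert (d <= e / 2) by apply Rmin_l. assert (d <= 1 - s) by apply Rmin_r.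
      assert (B : s + d <= s).
      { apply U. split; [lra|]. apply Pe. rewrite Rabs_right; lra. }
      lra.
    + destruct (OQ s Hs Qs) as (e & He & Qe).
      assert (B : s <= s - e).
      { apply L. intros t [Ht Pt]. apply Rnot_lt_le. intro C.
        assert (t <= s) by (apply U; auto).
        apply (D t Ht Pt). apply Qe. apply Rabs_def1; lra. }
      lra.
Qed.

Lemma sq_lt_abs (x e : R) : 0 < e -> x ^ 2 < e ^ 2 -> Rabs x < e.
Proof. intros He H. apply Rabs_def1; nra. Qed.

Lemma open_cell_ball (A : list tline) (k : tline -> Z) (p : pt) :
  open_cell A k p ->
  exists eps, 0 < eps /\ forall q, dist2 p q < eps ^ 2 -> open_cell A k q.
Proof.
  induction A as [|l A IH]; intro H.
  - exists 1. split; [lra|]. intros q _ l [].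
  - destruct IH as (e1 & He1 & P1); [intros l' Hl'; apply H; right; auto|].
    assert (Hl := H l (or_introl eq_refl)).
    assert (P : exists e, 0 < e /\ forall q, dist2 p q < e ^ 2 ->
       IZR (k l) < lval l q < IZR (k l) + 1).
    { set (r := Rmin (lval l p - IZR (k l)) (IZR (k l) + 1 - lval l p)).
      assert (Hr : 0 < r) by (apply Rmin_glb_lt; lra).
      assert (Hr1 : r <= lval l p - IZR (k l)) by apply Rmin_l.
      assert (Hr2 : r <= IZR (k l) + 1 - lval l p) by apply Rmin_r.
      clearbody r. destruct l as [[a b] c]. simpl lval in *.
      set (M := Rabs (IZR a) + Rabs (IZR b) + 1).
      pose proof (Rabs_pos (IZR a)) as Pa. pose proof (Rabs_pos (IZR b)) as Pb.
      assert (HM : 0 < M) by (unfold M; lra).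
      assert (He : 0 < r / M) by (apply Rdiv_lt_0_compat; auto).
      exists (r / M). split; auto. intros q Hq. unfold dist2 in Hq.
      assert (Hx : Rabs (fst p - fst q) < r / M).
      { apply sq_lt_abs; auto. pose proof (pow2_ge_0 (snd p - snd q)). lra. }
      assert (Hy : Rabs (snd p - snd q) < r / M).
      { apply sq_lt_abs; auto. pose proof (pow2_ge_0 (fst p - fst q)). lra. }
      assert (B : Rabs (IZR a * (fst p - fst q) + IZR b * (snd p - snd q)) < r).
      { eapply Rle_lt_trans; [apply Rabs_triang|]. rewrite !Rabs_mult.
        apply Rle_lt_trans with ((Rabs (IZR a) + Rabs (IZR b)) * (r / M)); [nra|].
        replace r with (M * (r / M)) at 2 by (field; lra).
        apply Rmult_lt_compat_r; auto. unfold M; lra. }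
      apply Rabs_def2 in B. lra. }
    destruct P as (e2 & He2 & P2). exists (Rmin e1 e2).
    assert (Hm : 0 < Rmin e1 e2) by (apply Rmin_glb_lt; auto).
    split; auto. intros q Hq.
    pose proof (Rmin_l e1 e2). pose proof (Rmin_r e1 e2).
    intros l' [<-|Hl'].
    + apply P2. nra.
    + apply P1; auto. nra.
Qed.

Definition cell_orbit (A : list tline) (k : tline -> Z) (x : pt) : Prop :=
  exists m n, open_cell A k (shift x m n).

Lemma cell_orbit_z2inv (A : list tline) (k : tline -> Z) : z2inv (cell_orbit A k).
Proof.
  intros p m n. split; intros (m' & n' & H).
  - exists (- m + m')%Z, (- n + n')%Z. rewrite <- shift_shift, shift_opp. auto.
  - exists (m + m')%Z, (n + n')%Z. rewrite <- shift_shift. auto.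
Qed.

Lemma compl_shift (A : list tline) (p : pt) (m n : Z) :
  lines_ok A -> compl A p -> compl A (shift p m n).
Proof.
  intros ok H. apply compl_iff; auto. intros l Hl. rewrite is_int_shift.
  exact (proj1 (compl_iff A p ok) H l Hl).
Qed.

Lemma openR2_line (U : pt -> Prop) (p u : pt) (t : R) :
  openR2 U -> U (vadd p t u) ->
  exists e, 0 < e /\ forall s, Rabs (s - t) < e -> U (vadd p s u).
Proof.
  intros O H. destruct (O _ H) as (e & He & B).
  (* [M - 1] is the squared length of [u]; the radius e / M works because [M - 1 < M * M]. *)
  set (M := fst u ^ 2 + snd u ^ 2 + 1).
  assert (HM : 1 <= M)
    by (unfold M; pose proof (pow2_ge_0 (fst u)); pose proof (pow2_ge_0 (snd u)); lra).
  exists (e / M). assert (Hd : 0 < e / M) by (apply Rdiv_lt_0_compat; lra).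
  split; auto. intros s Hs. apply B. unfold dist2, vadd; simpl.
  apply Rabs_def2 in Hs.
  replace ((_ - _) * _ + _) with ((s - t) ^ 2 * (M - 1)) by (unfold M; ring).
  assert (E : e = e / M * M) by (field; lra).
  set (d := e / M) in *. clearbody d. rewrite E.
  assert (Q : (s - t) ^ 2 < d ^ 2) by nra.
  pose proof (pow2_ge_0 (s - t)).
  assert ((s - t) ^ 2 * (M - 1) <= d ^ 2 * (M - 1)) by (apply Rmult_le_compat_r; lra).
  assert (0 < d ^ 2) by lra.
  replace ((d * M) * ((d * M) * 1)) with (d ^ 2 * (M * M)) by ring.
  assert (d ^ 2 * (M - 1) < d ^ 2 * (M * M)) by (apply Rmult_lt_compat_l; nra). lra.
Qed.

(** The separating sets are invariant, so both witnesses can be translated into the one convex cell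
    with label [k], where a segment joins them. *)
Lemma cell_orbit_connected (A : list tline) (k : tline -> Z) :
  torus_connected (cell_orbit A k).
Proof.
  intros (U & V & [IU OU] & [IV OV] & Cov & (x & (mx & nx & Hx) & Ux)
    & (y & (my & ny & Hy) & Vy) & Dis).
  apply IU with (m := mx) (n := nx) in Ux. apply IV with (m := my) (n := ny) in Vy.
  set (x' := shift x mx nx) in *. set (y' := shift y my ny) in *.
  assert (Seg : forall t, 0 <= t <= 1 -> cell_orbit A k (vadd x' t (vsub y' x'))).
  { intros t Ht. exists 0%Z, 0%Z. rewrite shift_0.
    destruct (Req_dec t 0) as [->|N]; [rewrite vadd_0; auto|].
    apply open_cell_segment; auto; [|lra]. apply open_closed_cell; auto. }
  apply (interval_connected (fun t => U (vadd x' t (vsub y' x')))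
                            (fun t => V (vadd x' t (vsub y' x')))).
  - rewrite vadd_0; auto.
  - rewrite vadd_vsub; auto.
  - intros t Ht. apply Cov. auto.
  - intros t Ht HU HV. apply (Dis _ (Seg t Ht)); auto.
  - intros t _ HU. apply openR2_line; auto.
  - intros t _ HV. apply openR2_line; auto.
Qed.

(** The orbit of the cell of [p] and the rest of the complement are disjoint, open and invariant, so
    a connected set through [p] stays in the orbit. Conversely the orbit itself is a connecting
    set. *)
Lemma same_chamber_iff (A : list tline) (p q : pt) :
  lines_ok A -> (same_chamber A p q <-> compl A p /\ cell_orbit A (floors p) q).
Proof.
  intro ok. split.
  - intros (S & IS & CS & SA & Sp & Sq). assert (Cp := SA p Sp). split; auto.
    apply NNPP. intro N. apply CS.
    exists (cell_orbit A (floors p)), (fun x => compl A x /\ ~ cell_orbit A (floors p) x).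
    assert (HP : cell_orbit A (floors p) p).
    { exists 0%Z, 0%Z. rewrite shift_0. apply open_cell_floors; auto. }
    split; [|split; [|split; [|split; [|split]]]].
    + split; [apply cell_orbit_z2inv|].
      intros x (m & n & Hx). destruct (open_cell_ball _ _ _ Hx) as (e & He & B).
      exists e. split; auto. intros y Hy. exists m, n. apply B.
      unfold dist2, shift in *; simpl in *.
      replace (_ + _) with ((fst x - fst y) * ((fst x - fst y) * 1)
        + (snd x - snd y) * ((snd x - snd y) * 1)) by ring. auto.
    + split.
      * intros x m n. rewrite <- (cell_orbit_z2inv A (floors p) x m n).
        split; intros [H1 H2]; split; auto; [apply compl_shift; auto|].
        rewrite <- (shift_opp x m n). apply compl_shift; auto.
      * intros x [Cx Nx].
        destruct (open_cell_ball _ _ _ (open_cell_floors A x ok Cx)) as (e & He & B).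
        exists e. split; auto. intros y Hy. specialize (B y Hy).
        split; [apply (open_cell_compl A (floors x)); auto|].
        (* [y] lies in the cell of [x], so the translation taking [y] into the cell of [p] takes the
           whole cell of [x] there. *)
        intros (m & n & Hn). apply Nx. exists m, n.
        apply (open_cell_ext A (kshift (floors x) m n)).
        -- apply (open_cell_unique A _ _ (shift y m n)); auto. apply open_cell_shift; auto.
        -- apply open_cell_shift.
           apply open_cell_floors; auto.
    + intros x Sx. destruct (classic (cell_orbit A (floors p) x)); auto.
    + exists p; auto.
    + exists q; auto.
    + intros x Sx Ux [_ Nx]. auto.
  - intros [Cp Oq]. exists (cell_orbit A (floors p)).
    split; [apply cell_orbit_z2inv|]. split; [apply cell_orbit_connected|].
    split; [|split; auto].
    + intros x (m & n & Hx). rewrite <- (shift_opp x m n). apply compl_shift; auto.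
      apply (open_cell_compl A (floors p)); auto.
    + exists 0%Z, 0%Z. rewrite shift_0. apply open_cell_floors; auto.
Qed.

(** * Vertices and degrees *)

(** Proportional primitive vectors differ by a sign [e], recovered from Bezout coefficients as
    [u * a' + v * b']. *)
Lemma ldet_zero_multiple (a b a' b' : Z) (c c' : R) :
  tline_ok (a, b, c) -> tline_ok (a', b', c') -> ldet (a, b, c) (a', b', c') = 0%Z ->
  exists e : Z, (e * e = 1)%Z /\ (a' = e * a)%Z /\ (b' = e * b)%Z.
Proof.
  simpl. intros G G' D. destruct (Z.gcd_bezout a b 1 G) as (u & v & H).
  set (e := (u * a' + v * b')%Z).
  assert (Ea : (a' = e * a)%Z)
    by (unfold e; transitivity (a' * (u * a + v * b) + v * (a * b' - b * a'))%Z;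
        [rewrite H, D|]; ring).
  assert (Eb : (b' = e * b)%Z)
    by (unfold e; transitivity (b' * (u * a + v * b) - u * (a * b' - b * a'))%Z;
        [rewrite H, D|]; ring).
  exists e. split; [|split; auto].
  rewrite Ea, Eb, Z.gcd_mul_mono_l, G in G'. nia.
Qed.

(** The sign relating the two primitive vectors enters squared. Comparing sides through products
    thus requires no common orientation of parallel lines. *)
Lemma ldet_zero_sign (l l' : tline) :
  tline_ok l -> tline_ok l' -> ldet l l' = 0%Z ->
  forall u w, ldir l u * ldir l w = ldir l' u * ldir l' w.
Proof.
  destruct l as [[a b] c], l' as [[a' b'] c']. intros G G' D u w.
  destruct (ldet_zero_multiple _ _ _ _ _ _ G G' D) as (e & He & -> & ->). simpl.
  rewrite !mult_IZR.
  assert (E : IZR e * IZR e = 1) by (rewrite <- mult_IZR, He; reflexivity).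
  transitivity (IZR e * IZR e * ((IZR a * fst u + IZR b * snd u) *
    (IZR a * fst w + IZR b * snd w))); [rewrite E; ring|ring].
Qed.

Lemma parallel_same_tline (l l' : tline) (v : pt) :
  tline_ok l -> tline_ok l' -> ldet l l' = 0%Z ->
  is_int (lval l v) -> is_int (lval l' v) -> same_tline l l'.
Proof.
  intros G G' D [z Hz] [z' Hz'] p. rewrite !on_tline_iff by auto.
  destruct l as [[a b] c], l' as [[a' b'] c'].
  destruct (ldet_zero_multiple _ _ _ _ _ _ G G' D) as (e & He & -> & ->).
  assert (E : IZR e * IZR e = 1) by (rewrite <- mult_IZR, He; reflexivity).
  cbn [lval] in *. rewrite !mult_IZR in *.
  split; intros [y Hy].
  - exists (e * (y - z) + z')%Z. rewrite plus_IZR, mult_IZR, minus_IZR.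
    rewrite <- Hy, <- Hz, <- Hz'. ring.
  - exists (e * (y - z') + z)%Z. rewrite plus_IZR, mult_IZR, minus_IZR.
    rewrite <- Hy, <- Hz, <- Hz'.
    transitivity (IZR e * IZR e * (IZR a * fst p + IZR b * snd p)
      - IZR e * IZR e * (IZR a * fst v + IZR b * snd v)
      + IZR a * fst v + IZR b * snd v - c); [rewrite E; ring|ring].
Qed.

(** If the lines were transverse, then walking along [l] from a common point would reach a point
    where [lval l'] is 1/2, which is on [l] but not on [l']. *)
Lemma same_tline_parallel (l l' : tline) :
  tline_ok l -> tline_ok l' -> same_tline l l' -> ldet l l' = 0%Z.
Proof.
  intros G G' S. apply NNPP. intro D.
  set (p := cramer l l' 0 0).
  assert (P : lval l p = 0 /\ lval l' p = 0).
  { unfold p. destruct l as [[a b] c], l' as [[a' b'] c']; simpl in *.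
    assert (D' : IZR a * IZR b' - IZR b * IZR a' <> 0)
      by (rewrite <- !mult_IZR, <- minus_IZR; apply not_0_IZR; exact D).
    split; field; auto. }
  set (u := let '(a, b, _) := l in (- IZR b, IZR a)).
  assert (U1 : ldir l u = 0) by (unfold u; destruct l as [[a b] c]; simpl; ring).
  assert (U2 : ldir l' u <> 0).
  { intro E. assert (Z := ldir_both_zero l l' u D U1 E).
    unfold u in Z. destruct l as [[a b] c]; simpl in *. injection Z as Zb Za.
    assert (Zb' : IZR b = 0) by lra. apply eq_IZR in Za, Zb'. subst. discriminate. }
  assert (H : is_int (lval l' (vadd p (/ 2 * / ldir l' u) u))).
  { apply on_tline_iff; auto. apply S. apply on_tline_iff; auto.
    exists 0%Z. rewrite lval_vadd, U1. destruct P as [-> _]. ring. }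
  destruct H as [z Hz]. rewrite lval_vadd in Hz. destruct P as [_ P].
  rewrite P in Hz. replace (0 + / 2 * / ldir l' u * ldir l' u) with (/ 2) in Hz by (field; auto).
  apply (IZR_strict_between 0 z); lra.
Qed.

Lemma arrangement_lines_ok (A : list tline) : arrangement A -> lines_ok A.
Proof. intros [H _]. exact H. Qed.

Lemma arrangement_spanning (A : list tline) : arrangement A -> spanning A.
Proof.
  intros (ok & _ & N). apply NNPP. intro S. apply N.
  destruct A as [|[[a b] c] A].
  - exists 1%Z, 0%Z. split; [reflexivity|]. intros l [].
  - assert (G := ok _ (or_introl eq_refl)).
    exists a, b. split; [exact G|]. intros [[a' b'] c'] Hl.
    assert (G' := ok _ Hl).
    assert (D : ldet (a, b, c) (a', b', c') = 0%Z).
    { apply NNPP. intro D. apply S. exists (a, b, c), (a', b', c'). split; [left|]; auto. }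
    destruct (ldet_zero_multiple _ _ _ _ _ _ G G' D) as (e & He & Ea & Eb).
    (* Since [e] is its own inverse, (a', b', c') is the line (a, b, e c'); Bezout supplies the
       common point (e c' u, e c' v). *)
    exists (IZR e * c').
    destruct (Z.gcd_bezout a b 1 G) as (u & v & H).
    apply (parallel_same_tline _ _ (IZR e * c' * IZR u, IZR e * c' * IZR v)); auto.
    + simpl. rewrite Ea, Eb. ring.
    + exists 0%Z. rewrite Ea, Eb. simpl. rewrite !mult_IZR.
      assert (E1 : IZR u * IZR a + IZR v * IZR b = 1)
        by (rewrite <- !mult_IZR, <- plus_IZR, H; reflexivity).
      assert (E : IZR e * IZR e = 1) by (rewrite <- mult_IZR, He; reflexivity).
      transitivity (IZR e * IZR e * c' * (IZR u * IZR a + IZR v * IZR b) - c');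
        [ring|rewrite E, E1; ring].
    + exists 0%Z. simpl.
      assert (E1 : IZR u * IZR a + IZR v * IZR b = 1)
        by (rewrite <- !mult_IZR, <- plus_IZR, H; reflexivity).
      transitivity (IZR e * c' * (IZR u * IZR a + IZR v * IZR b) - IZR e * c');
        [ring|rewrite E1; ring].
Qed.

Lemma concurrent_not_parallel (A : list tline) (v : pt) (i j : nat) :
  arrangement A -> (i < length A)%nat -> (j < length A)%nat -> i <> j ->
  on_tline (lineA A i) v -> on_tline (lineA A j) v ->
  ldet (lineA A i) (lineA A j) <> 0%Z.
Proof.
  intros (ok & D & _) Hi Hj N Oi Oj E.
  assert (Ai : In (lineA A i) A) by (apply nth_In; auto).
  assert (Aj : In (lineA A j) A) by (apply nth_In; auto).
  apply (D i j Hi Hj N). apply (parallel_same_tline _ _ v); auto.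
  - apply on_tline_iff; auto.
  - apply on_tline_iff; auto.
Qed.

(** Parallel toric lines with a common point coincide, so distinct lines meeting at [v] are
    transverse; transverse lines conversely have different indices. *)
Lemma vertex_iff (A : list tline) (v : pt) :
  arrangement A -> (vertex A v <-> crossing A v).
Proof.
  intros H. assert (ok := arrangement_lines_ok A H). split.
  - intros (i & j & Hi & Hj & N & Oi & Oj).
    assert (Ai : In (lineA A i) A) by (apply nth_In; auto).
    assert (Aj : In (lineA A j) A) by (apply nth_In; auto).
    exists (lineA A i), (lineA A j). split; [|split; [|split; [|split]]]; auto.
    + apply (concurrent_not_parallel A v); auto.
    + apply on_tline_iff; auto.
    + apply on_tline_iff; auto.
  - intros (l1 & l2 & H1 & H2 & D & I1 & I2).
    destruct (In_nth A l1 (0%Z, 0%Z, 0) H1) as (i & Hi & Ei).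
    destruct (In_nth A l2 (0%Z, 0%Z, 0) H2) as (j & Hj & Ej).
    exists i, j. unfold lineA. rewrite Ei, Ej. repeat split; auto.
    + intros <-. apply D. rewrite <- Ei, <- Ej.
      destruct (nth i A (0%Z, 0%Z, 0)) as [[a b] c]. simpl. ring.
    + apply on_tline_iff; auto.
    + apply on_tline_iff; auto.
Qed.

(** Degree at least three, phrased by pairwise transversality rather than indices so that it applies
    directly to cells. *)
Definition triple_point (A : list tline) (v : pt) : Prop :=
  exists l1 l2 l3, In l1 A /\ In l2 A /\ In l3 A /\
    is_int (lval l1 v) /\ is_int (lval l2 v) /\ is_int (lval l3 v) /\
    ldet l1 l2 <> 0%Z /\ ldet l1 l3 <> 0%Z /\ ldet l2 l3 <> 0%Z.

Lemma ldet_diag (l : tline) : ldet l l = 0%Z.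
Proof. destruct l as [[a b] c]; simpl; ring. Qed.

Lemma ldet_sym (l l' : tline) : ldet l l' = (- ldet l' l)%Z.
Proof. destruct l as [[a b] c], l' as [[a' b'] c']; simpl; ring. Qed.

Lemma simple_iff (A : list tline) :
  arrangement A -> (simple A <-> forall v, ~ triple_point A v).
Proof.
  intro H. assert (ok := arrangement_lines_ok A H). split.
  - intros S v (l1 & l2 & l3 & H1 & H2 & H3 & I1 & I2 & I3 & D12 & D13 & D23).
    assert (V : vertex A v).
    { apply vertex_iff; auto. exists l1, l2. auto. }
    destruct (S v V) as (idx & ND & L & Hidx).
    destruct idx as [|i [|j [|]]]; try discriminate.
    assert (Q : forall l, In l A -> is_int (lval l v) -> l = lineA A i \/ l = lineA A j).
    { intros l Hl Il. destruct (In_nth A l (0%Z, 0%Z, 0) Hl) as (m & Hm & Em).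
      assert (Im : In m (i :: j :: nil)).
      { apply Hidx. split; auto. unfold lineA. rewrite Em. apply on_tline_iff; auto. }
      destruct Im as [<-|[<-|[]]]; auto. }
    destruct (Q l1 H1 I1) as [->| ->]; destruct (Q l2 H2 I2) as [->| ->];
      try (apply D12; apply ldet_diag);
      destruct (Q l3 H3 I3) as [->| ->];
      try (apply D13; apply ldet_diag); apply D23; apply ldet_diag.
  - intros T v (i & j & Hi & Hj & N & Oi & Oj). exists (i :: j :: nil).
    split; [|split; [reflexivity|]].
    + constructor; [intros [E|[]]; auto|]. constructor; [intros []|constructor].
    + intros m. split.
      * intros [<-|[<-|[]]]; auto.
      * intros [Hm Om].
        destruct (Nat.eq_dec i m) as [->|N1]; [left; auto|].
        destruct (Nat.eq_dec j m) as [->|N2]; [right; left; auto|].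
        exfalso. apply (T v). exists (lineA A i), (lineA A j), (lineA A m).
        assert (Ai : In (lineA A i) A) by (apply nth_In; auto).
        assert (Aj : In (lineA A j) A) by (apply nth_In; auto).
        assert (Am : In (lineA A m) A) by (apply nth_In; auto).
        split; auto. split; auto. split; auto.
        split; [apply on_tline_iff; auto|]. split; [apply on_tline_iff; auto|].
        split; [apply on_tline_iff; auto|].
        split; [|split]; apply (concurrent_not_parallel A v); auto.
Qed.

(** * Highest vertices *)

Lemma avoid_finite (L : list R) (lo hi : R) :
  lo < hi -> exists s, lo < s < hi /\ ~ In s L.
Proof.
  revert lo. induction L as [|r L IH]; intros lo H.
  - exists ((lo + hi) / 2). split; [lra|intros []].
  - destruct (Rlt_dec (Rmax lo r) hi) as [C|C].
    + destruct (IH _ C) as (s & Hs & N). pose proof (Rmax_l lo r). pose proof (Rmax_r lo r).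
      exists s. split; [lra|]. intros [E|I]; auto. lra.
    + destruct (IH lo H) as (s & Hs & N). exists s. split; auto.
      intros [E|I]; auto. apply C. apply Rmax_lub_lt; lra.
Qed.

(** Each line rules out at most one slope [s] of a direction (1, s). *)
Lemma generic_exists (A : list tline) : lines_ok A -> exists h, generic A h.
Proof.
  intro ok.
  destruct (avoid_finite (map (fun l : tline =>
    - IZR (fst (fst l)) / IZR (snd (fst l))) A) 0 1 ltac:(lra)) as (s & _ & Hs).
  exists (1, s). intros l Hl E. assert (G := ok l Hl).
  destruct (Z.eq_dec (snd (fst l)) 0) as [Z0|N0].
  - destruct l as [[a b] c]; simpl in *. subst b.
    assert (Za : IZR a = 0) by lra. apply eq_IZR in Za. subst. discriminate.
  - apply Hs. apply in_map_iff. exists l. split; auto.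
    destruct l as [[a b] c]; simpl in *.
    assert (Nb : IZR b <> 0) by (apply not_0_IZR; auto).
    apply (Rmult_eq_reg_l (IZR b)); auto. transitivity (- IZR a); [field; auto|lra].
Qed.

Definition down (h : pt) : pt := (snd h, - fst h).

Lemma cross_down_neg (h : pt) : h <> (0, 0) -> cross h (down h) < 0.
Proof.
  intro N. pose proof (cross_perp_pos h N). unfold cross, down, perp in *; simpl in *; lra.
Qed.

(** Coordinates in the basis [down h], [h]: [a > 0] means that [u] descends, and [b] is the level
    displacement. *)
Lemma down_coords (h u : pt) :
  h <> (0, 0) -> exists a b, cross h u = a * cross h (down h) /\
    (forall l, ldir l u = a * ldir l (down h) + b * ldir l h) /\
    (a = 0 -> b = 0 -> u = (0, 0)).
Proof.
  intro N. pose proof (cross_down_neg h N) as C.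
  set (a := cross h u / cross h (down h)).
  destruct (cross_colinear h (vadd u (- a) (down h)) N) as [b Hb].
  { rewrite cross_vadd. unfold a. field. lra. }
  exists a, b. injection Hb as Hx Hy. split; [unfold a; field; lra|]. split.
  - intros [[p q] c]. clearbody a. unfold down in *. simpl in *.
    assert (Ex : fst u = b * fst h + a * snd h) by lra.
    assert (Ey : snd u = b * snd h - a * fst h) by lra.
    rewrite Ex, Ey. ring.
  - intros Za Zb. clearbody a. subst a b. destruct u as [x y]; simpl in *.
    f_equal; lra.
Qed.

(* The line [v + R (down h + s h)] is parallel to [l] exactly for [s = root h l]. *)
Definition root (h : pt) (l : tline) : R := - ldir l (down h) / ldir l h.

Lemma ldir_down (h : pt) (l : tline) :
  ldir l h <> 0 -> ldir l (down h) = - root h l * ldir l h.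
Proof. intro N. unfold root. field. auto. Qed.

Lemma ldir_slope (h : pt) (l : tline) (s : R) :
  ldir l h <> 0 -> ldir l (vadd (down h) s h) = ldir l h * (s - root h l).
Proof. intro N. rewrite ldir_vadd, ldir_down by auto. ring. Qed.

Lemma root_neq (h : pt) (l l' : tline) :
  ldir l h <> 0 -> ldir l' h <> 0 -> ldet l l' <> 0%Z -> root h l <> root h l'.
Proof.
  intros N N' D E.
  assert (Z : vadd (down h) (root h l) h = (0, 0)).
  { apply (ldir_both_zero l l'); auto; rewrite ldir_slope by auto; [|rewrite E]; ring. }
  assert (Nh : h <> (0, 0)).
  { intros ->. apply N. destruct l as [[a b] c]; simpl; ring. }
  pose proof (cross_down_neg h Nh) as C.
  assert (C' : cross h (vadd (down h) (root h l) h) = 0)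
    by (rewrite Z; unfold cross; simpl; ring).
  rewrite cross_vadd in C'. replace (cross h h) with 0 in C' by (unfold cross; ring). lra.
Qed.

(** For a slope strictly between two roots the germ lies in the downward wedge bounded by [l1] and
    [l2]. By [germ_sign] the whole cell does, and [v] is the strict highest point of that wedge. *)
Lemma top_of_slope (A : list tline) (h v : pt) (s : R) (l1 l2 : tline) :
  spanning A -> generic A h -> crossing A v -> In l1 A -> In l2 A ->
  is_int (lval l1 v) -> is_int (lval l2 v) -> root h l1 < s < root h l2 ->
  ~ In s (map (root h) A) ->
  exists k, germ A k v (vadd (down h) s h) /\ top A h k v.
Proof.
  intros sp G X H1 H2 I1 I2 Hs Ns. set (u := vadd (down h) s h).
  exists (germ_floors v u).
  assert (Ge : germ A (germ_floors v u) v u).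
  { apply germ_exists. intros l Hl _ E. unfold u in E. rewrite ldir_slope in E by (apply G; auto).
    destruct (Rmult_integral _ _ E) as [E'|E']; [apply (G l Hl E')|].
    apply Ns. apply in_map_iff. exists l. split; auto. lra. }
  split; auto. split; [eapply germ_closed; eauto|]. split; auto.
  intros q Hq N. assert (N0 := generic_nonzero A h sp G).
  destruct (down_coords h (vsub q v) N0) as (a & b & Ec & El & Ez).
  pose proof (cross_down_neg h N0) as C.
  rewrite cross_vsub in Ec.
  assert (S : forall l, In l A -> is_int (lval l v) -> 0 <= (s - root h l) * (b - a * root h l)).
  { intros l Hl Il. pose proof (germ_sign A _ v u q l Ge Hq Hl Il) as P.
    assert (Gl := G l Hl).
    rewrite <- ldir_vsub, El in P. unfold u in P. rewrite ldir_slope, ldir_down in P by auto.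
    replace (ldir l h * (s - root h l) * (a * (- root h l * ldir l h) + b * ldir l h))
      with ((ldir l h * ldir l h) * ((s - root h l) * (b - a * root h l))) in P by ring.
    assert (0 < ldir l h * ldir l h) by (destruct (Rdichotomy _ _ Gl); nra).
    apply Rnot_lt_le. intro. nra. }
  assert (S1 := S l1 H1 I1). assert (S2 := S l2 H2 I2).
  assert (T1 : 0 <= b - a * root h l1) by (apply Rnot_lt_le; intro; nra).
  assert (T2 : b - a * root h l2 <= 0) by (apply Rnot_lt_le; intro; nra).
  (* The side conditions say that [b] lies between [a * root h l1] and [a * root h l2]; hence [a] is
     nonnegative, and [a = 0] forces [b = 0], that is [q = v]. *)
  assert (Pa : 0 < a).
  { destruct (Rtotal_order a 0) as [La|[Za|Pa]]; auto; exfalso.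
    - nra.
    - assert (b = 0) by (rewrite Za in *; lra).
      assert (Z := Ez Za H). apply N.
      destruct q, v; unfold vsub in Z; simpl in Z; injection Z as Zx Zy. f_equal; lra. }
  nra.
Qed.

Lemma crossing_roots (A : list tline) (h v : pt) :
  generic A h -> crossing A v ->
  exists l1 l2, In l1 A /\ In l2 A /\ is_int (lval l1 v) /\ is_int (lval l2 v) /\
    ldet l1 l2 <> 0%Z /\ root h l1 < root h l2.
Proof.
  intros G (l1 & l2 & H1 & H2 & D & I1 & I2).
  destruct (Rdichotomy _ _ (root_neq h l1 l2 (G l1 H1) (G l2 H2) D)).
  - exists l1, l2. repeat split; auto.
  - exists l2, l1. repeat split; auto. rewrite ldet_sym. lia.
Qed.

Lemma top_cell_exists (A : list tline) (h v : pt) :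
  spanning A -> generic A h -> crossing A v ->
  exists k p, open_cell A k p /\ top A h k v.
Proof.
  intros sp G X. destruct (crossing_roots A h v G X) as (l1 & l2 & H1 & H2 & I1 & I2 & _ & L).
  destruct (avoid_finite (map (root h) A) _ _ L) as (s & Hs & Ns).
  destruct (top_of_slope A h v s l1 l2) as (k & Ge & T); auto.
  destruct (germ_point _ _ _ _ Ge) as (t & _ & O). eauto.
Qed.

Lemma sort3 (P : tline -> Prop) (f : tline -> R) (x y z : tline) :
  P x -> P y -> P z -> f x <> f y -> f x <> f z -> f y <> f z ->
  exists a b c, P a /\ P b /\ P c /\ f a < f b < f c.
Proof.
  intros Px Py Pz Nxy Nxz Nyz.
  destruct (Rdichotomy _ _ Nxy), (Rdichotomy _ _ Nxz), (Rdichotomy _ _ Nyz);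
    [exists x, y, z|exists x, z, y|exists x, y, z|exists z, x, y
    |exists y, x, z|exists x, y, z|exists y, z, x|exists z, y, x];
    repeat split; auto; lra.
Qed.

(** Three lines through [v] have three distinct roots; slopes from the two gaps give cells below [v]
    on opposite sides of the middle line. *)
Lemma triple_point_top_cells (A : list tline) (h v : pt) :
  spanning A -> generic A h -> triple_point A v ->
  exists k p k' p', open_cell A k p /\ open_cell A k' p' /\
    top A h k v /\ top A h k' v /\ ~ (forall l, In l A -> k l = k' l).
Proof.
  intros sp G (l1 & l2 & l3 & H1 & H2 & H3 & I1 & I2 & I3 & D12 & D13 & D23).
  assert (X : crossing A v) by (exists l1, l2; auto).
  destruct (sort3 (fun l => In l A /\ is_int (lval l v)) (root h) l1 l2 l3)
    as (a & b & c & [Ha Ia] & [Hb Ib] & [Hc Ic] & Lab & Lbc); auto using root_neq.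
  destruct (avoid_finite (map (root h) A) _ _ Lab) as (s & Hs & Ns).
  destruct (avoid_finite (map (root h) A) _ _ Lbc) as (s' & Hs' & Ns').
  destruct (top_of_slope A h v s a b) as (k & Ge & T); auto.
  destruct (top_of_slope A h v s' b c) as (k' & Ge' & T'); auto.
  destruct (germ_point _ _ _ _ Ge) as (t & _ & O).
  destruct (germ_point _ _ _ _ Ge') as (t' & Ht' & O').
  exists k, (vadd v t (vadd (down h) s h)), k', (vadd v t' (vadd (down h) s' h)).
  split; auto. split; auto. split; auto. split; auto.
  (* Equal labels would put a point of the second cell into the first, on the wrong side of the line
     [b]. *)
  intro E. assert (Gb := G b Hb).
  pose proof (germ_sign A k v _ (vadd v t' (vadd (down h) s' h)) b Ge) as S.
  rewrite lval_vadd, !ldir_slope in S by auto.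
  assert (S' : closed_cell A k (vadd v t' (vadd (down h) s' h))).
  { apply open_closed_cell. apply (open_cell_ext A k'); auto. intros; symmetry; auto. }
  specialize (S S' Hb Ib).
  replace (ldir b h * (s - root h b) *
    (lval b v + t' * (ldir b h * (s' - root h b)) - lval b v))
    with ((ldir b h * ldir b h) * (t' * ((s - root h b) * (s' - root h b)))) in S by ring.
  assert (0 < ldir b h * ldir b h) by (destruct (Rdichotomy _ _ Gb); nra).
  assert ((s - root h b) * (s' - root h b) < 0) by nra.
  assert (t' * ((s - root h b) * (s' - root h b)) < 0) by nra.
  nra.
Qed.

(* At a double point the two lines cut the lower half plane into three sectors;
   only the middle one belongs to a cell with highest point [v]. *)
Lemma top_slope_between (A : list tline) (h : pt) (k : tline -> Z) (v p : pt) (l1 l2 : tline) :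
  spanning A -> generic A h -> In l1 A -> In l2 A ->
  is_int (lval l1 v) -> is_int (lval l2 v) -> root h l1 < root h l2 ->
  (forall l, In l A -> is_int (lval l v) -> forall u w,
     ldir l u * ldir l w = ldir l1 u * ldir l1 w \/ ldir l u * ldir l w = ldir l2 u * ldir l2 w) ->
  open_cell A k p -> top A h k v ->
  0 < ldir l1 h * ldir l1 (vsub p v) /\ ldir l2 h * ldir l2 (vsub p v) < 0.
Proof.
  intros sp G H1 H2 I1 I2 L Two O (Cv & X & M).
  assert (N0 := generic_nonzero A h sp G).
  pose proof (cross_down_neg h N0) as C.
  assert (Ge := germ_segment A k v p Cv O).
  assert (Npv : p <> v).
  { intros ->. destruct I1 as [z Hz]. specialize (O l1 H1).
    apply (IZR_strict_between (k l1) z); lra. }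
  assert (Mp := M p (open_closed_cell _ _ _ O) Npv).
  destruct (down_coords h (vsub p v) N0) as (a & b & Ec & El & _).
  rewrite cross_vsub in Ec. assert (Pa : 0 < a) by nra.
  assert (G1 := G l1 H1). assert (G2 := G l2 H2).
  assert (E1 : ldir l1 h * ldir l1 (vsub p v) = ldir l1 h * ldir l1 h * (b - a * root h l1))
    by (rewrite El, ldir_down by auto; ring).
  assert (E2 : ldir l2 h * ldir l2 (vsub p v) = ldir l2 h * ldir l2 h * (b - a * root h l2))
    by (rewrite El, ldir_down by auto; ring).
  assert (P1 : 0 < ldir l1 h * ldir l1 h) by (destruct (Rdichotomy _ _ G1); nra).
  assert (P2 : 0 < ldir l2 h * ldir l2 h) by (destruct (Rdichotomy _ _ G2); nra).
  assert (T1 : ldir l1 (vsub p v) <> 0) by (apply (germ_not_tangent A k v); auto).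
  assert (T2 : ldir l2 (vsub p v) <> 0) by (apply (germ_not_tangent A k v); auto).
  assert (Lab : a * root h l1 < a * root h l2) by (apply Rmult_lt_compat_l; auto).
  (* A level direction with the same signs as [p - v] would lead into the open cell at the height of
     [v]. This excludes the two outer sectors, which contain [h] or [- h]. *)
  assert (NH : forall g, cross h g = 0 -> g <> (0, 0) ->
    (0 < ldir l1 (vsub p v) * ldir l1 g) -> (0 < ldir l2 (vsub p v) * ldir l2 g) -> False).
  { intros g Cg Ng Q1 Q2.
    assert (Gg : germ A k v g).
    { apply (germ_transfer A k v (vsub p v)); auto. intros l Hl Il.
      destruct (Two l Hl Il (vsub p v) g) as [-> | ->]; auto. }
    destruct (germ_point _ _ _ _ Gg) as (t & Ht & Ot).
    destruct (classic (vadd v t g = v)) as [E|NE].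
    - apply Ng. destruct v, g; unfold vadd in E; simpl in *. injection E as Ex Ey.
      f_equal; nra.
    - assert (B := M _ (open_closed_cell _ _ _ Ot) NE).
      rewrite cross_vadd, Cg in B. lra. }
  split.
  - destruct (Rtotal_order 0 (ldir l1 h * ldir l1 (vsub p v))) as [P|[Z|N]]; auto; exfalso.
    + symmetry in Z. destruct (Rmult_integral _ _ Z); auto.
    + rewrite E1 in N. assert (b - a * root h l1 < 0) by (apply Rnot_le_lt; intro; nra).
      assert (b - a * root h l2 < 0) by lra.
      apply (NH (vopp h)); rewrite ?ldir_vopp.
      * unfold cross, vopp; simpl; ring.
      * intro Z. apply N0. destruct h; unfold vopp in Z; simpl in Z; injection Z as Zx Zy.
        f_equal; lra.
      * nra.
      * nra.
  - destruct (Rtotal_order 0 (ldir l2 h * ldir l2 (vsub p v))) as [P|[Z|N]]; auto; exfalso.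
    + rewrite E2 in P. assert (0 < b - a * root h l2) by (apply Rnot_le_lt; intro; nra).
      assert (0 < b - a * root h l1) by lra.
      apply (NH h); auto.
      * unfold cross; ring.
      * nra.
      * nra.
    + symmetry in Z. destruct (Rmult_integral _ _ Z); auto.
Qed.

Lemma same_sign_mul (d x y : R) : 0 < (d * x) * (d * y) -> 0 < x * y.
Proof.
  intro H. apply Rnot_le_lt. intro L.
  replace (d * x * (d * y)) with (d * d * (x * y)) in H by ring.
  pose proof (Rle_0_sqr d). unfold Rsqr in *. nra.
Qed.

(** Both cells leave [v] through the same sector, the one between the two lines below [v], so they
    have a common germ. *)
Lemma double_point_top_unique (A : list tline) (h : pt) (k k' : tline -> Z) (v p p' : pt) :
  lines_ok A -> spanning A -> generic A h -> ~ triple_point A v ->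
  open_cell A k p -> open_cell A k' p' -> top A h k v -> top A h k' v ->
  forall l, In l A -> k l = k' l.
Proof.
  intros ok sp G NT O O' T T'.
  destruct (crossing_roots A h v G (proj1 (proj2 T)))
    as (l1 & l2 & H1 & H2 & I1 & I2 & D & L).
  assert (Two : forall l, In l A -> is_int (lval l v) -> forall u w,
     ldir l u * ldir l w = ldir l1 u * ldir l1 w \/
     ldir l u * ldir l w = ldir l2 u * ldir l2 w).
  { intros l Hl Il u w.
    destruct (Z.eq_dec (ldet l l1) 0) as [E1|N1];
      [left; apply ldet_zero_sign; auto|].
    destruct (Z.eq_dec (ldet l l2) 0) as [E2|N2];
      [right; apply ldet_zero_sign; auto|].
    exfalso. apply NT. exists l, l1, l2. repeat split; auto. }
  destruct (top_slope_between A h k v p l1 l2) as [S1 S2]; auto.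
  destruct (top_slope_between A h k' v p' l1 l2) as [S1' S2']; auto.
  apply (germ_unique A k k' v (vsub p' v)).
  - apply (germ_transfer A k v (vsub p v)).
    + apply germ_segment; auto. apply T.
    + intros l Hl Il. destruct (Two l Hl Il (vsub p v) (vsub p' v)) as [-> | ->].
      * apply (same_sign_mul (ldir l1 h)). nra.
      * apply (same_sign_mul (ldir l2 h)). nra.
  - apply germ_segment; auto. apply T'.
Qed.

(** * Middle vertices and triangles *)

(** Vertices are extreme points: being able to move both ways along [u] makes [u] parallel to every
    wall through [w], and two of these are transverse. *)
Lemma crossing_extreme (A : list tline) (k : tline -> Z) (w u : pt) (t1 t2 : R) :
  crossing A w -> closed_cell A k w -> 0 < t1 -> 0 < t2 ->
  closed_cell A k (vadd w t1 u) -> closed_cell A k (vadd w (- t2) u) -> u = (0, 0).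
Proof.
  intros (l1 & l2 & H1 & H2 & D & I1 & I2) Cw P1 P2 C1 C2.
  assert (Z : forall l, In l A -> is_int (lval l w) -> ldir l u = 0).
  { intros l Hl Il. specialize (C1 l Hl). specialize (C2 l Hl).
    rewrite lval_vadd in *.
    destruct (is_int_strip _ _ (Cw l Hl) Il) as [E|E]; rewrite E in *.
    - assert (0 <= ldir l u) by (apply Rnot_lt_le; intro; nra).
      assert (ldir l u <= 0) by (apply Rnot_lt_le; intro; nra). lra.
    - assert (0 <= ldir l u) by (apply Rnot_lt_le; intro; nra).
      assert (ldir l u <= 0) by (apply Rnot_lt_le; intro; nra). lra. }
  apply (ldir_both_zero l1 l2); auto.
Qed.

Definition side (b : bool) (h : pt) : pt := if b then h else vopp h.

Lemma cross_side (b : bool) (h : pt) : cross h (side b h) = 0.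
Proof. destruct b; unfold cross, side, vopp; simpl; ring. Qed.

Lemma vsub_zero (p q : pt) : vsub p q = (0, 0) -> p = q.
Proof.
  destruct p, q; unfold vsub; simpl; intro E; injection E as Ex Ey. f_equal; lra.
Qed.

(** [z] is the point of the chord from [v0] to [v1] at the height of [w], and it differs from [w] by
    extremity. The level segment from [w] to [z] therefore enters the open cell, and [w] is off the
    line of the chord. *)
Lemma middle_vertex_germ (A : list tline) (h : pt) (k : tline -> Z) (v0 v1 w : pt) :
  spanning A -> generic A h -> top A h k v1 -> top A (vopp h) k v0 ->
  crossing A w -> closed_cell A k w -> w <> v0 -> w <> v1 ->
  (exists b, germ A k w (side b h)) /\ cross (vsub w v0) (vsub v1 v0) <> 0.
Proof.
  intros sp G (C1 & _ & M1) (C0 & _ & M0) X Cw N0 N1.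
  assert (Nh := generic_nonzero A h sp G).
  assert (L1 := M1 w Cw N1). assert (L0 := M0 w Cw N0). rewrite !cross_vopp in L0.
  set (tau := (cross h w - cross h v0) / (cross h v1 - cross h v0)).
  set (z := vadd v0 tau (vsub v1 v0)).
  assert (Et : tau * (cross h v1 - cross h v0) = cross h w - cross h v0)
    by (unfold tau; field; lra).
  assert (T0 : 0 < tau) by (apply Rnot_le_lt; intro; nra).
  assert (T1 : tau < 1) by (apply Rnot_le_lt; intro; nra).
  clearbody tau.
  assert (Cz : closed_cell A k z) by (apply closed_cell_segment; auto; lra).
  assert (Hz : cross h w = cross h z)
    by (unfold z; rewrite cross_vadd, cross_vsub; lra).
  destruct (same_height h w z Nh Hz) as [t Ht].
  assert (Nt : t <> 0).
  { intros ->. rewrite vadd_0 in Ht.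
    assert (Z : vsub v1 v0 = (0, 0)).
    { apply (crossing_extreme A k w (vsub v1 v0) (1 - tau) tau); auto; try lra.
      - rewrite <- Ht. unfold z. rewrite vadd_vadd.
        replace (tau + (1 - tau)) with 1 by ring. rewrite vadd_vsub. auto.
      - rewrite <- Ht. unfold z. rewrite vadd_vadd, Rplus_opp_r, vadd_0. auto. }
    apply vsub_zero in Z. rewrite Z in L1. lra. }
  split.
  - rewrite Ht in Cz. exists (if Rlt_dec 0 t then true else false).
    pose proof (generic_segment_signed A k w h t G Cw Cz Nt) as Ge.
    unfold side. destruct (Rlt_dec 0 t); auto.
  - intro E.
    assert (Ex : fst w = fst v0 + tau * (fst v1 - fst v0) - t * fst h)
      by (apply (f_equal fst) in Ht; unfold z in Ht; simpl in Ht; lra).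
    assert (Ey : snd w = snd v0 + tau * (snd v1 - snd v0) - t * snd h)
      by (apply (f_equal snd) in Ht; unfold z in Ht; simpl in Ht; lra).
    assert (E' : t * (cross h v1 - cross h v0) = 0).
    { unfold cross, vsub in *; simpl in *. rewrite Ex, Ey in E. lra. }
    destruct (Rmult_integral _ _ E'); auto. lra.
Qed.

(** The open cell has a point off the line through [v0] and [v1]; moving from there to a vertex
    without coming closer to that line ends at a third vertex. The functional is [cross d] or its
    negative. *)
Lemma middle_vertex_exists (A : list tline) (h : pt) (k : tline -> Z) (v0 v1 p : pt) :
  lines_ok A -> spanning A -> generic A h -> open_cell A k p ->
  top A h k v1 -> top A (vopp h) k v0 ->
  exists w, crossing A w /\ closed_cell A k w /\ w <> v0 /\ w <> v1.
Proof.
  intros ok sp G O (C1 & X1 & M1) (C0 & X0 & M0).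
  assert (NP : forall v, crossing A v -> p <> v).
  { intros v (l & _ & Hl & _ & _ & [z Hz] & _) ->. specialize (O l Hl).
    apply (IZR_strict_between (k l) z); lra. }
  assert (Cp := open_closed_cell _ _ _ O).
  assert (L1 := M1 p Cp (NP v1 X1)). assert (L0 := M0 p Cp (NP v0 X0)).
  rewrite !cross_vopp in L0.
  set (d := vsub v1 v0).
  assert (Cd : cross d h < 0).
  { unfold d. replace (cross (vsub v1 v0) h) with (cross h v0 - cross h v1)
      by (unfold cross, vsub; simpl; ring). lra. }
  assert (E01 : cross d v0 = cross d v1) by (unfold d, cross, vsub; simpl; ring).
  assert (Q : exists q, closed_cell A k q /\ cross d q <> cross d v0).
  { destruct (Req_dec (cross d p) (cross d v0)) as [E|N]; [|eauto].
    destruct (germ_point _ _ _ _ (germ_interior A k p h O)) as (t & Ht & Ot).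
    exists (vadd p t h). split; [apply open_closed_cell; auto|].
    rewrite cross_vadd. nra. }
  destruct Q as (q & Cq & Nq). destruct (Rdichotomy _ _ Nq) as [L|L].
  - destruct (cell_vertex_above A k (vopp d) q ok sp Cq) as (w & Cw & Xw & Lw).
    rewrite !cross_vopp in Lw. exists w. split; [auto|split; [auto|split; intros ->; lra]].
  - destruct (cell_vertex_above A k d q ok sp Cq) as (w & Cw & Xw & Lw).
    exists w. split; [auto|split; [auto|split; intros ->; lra]].
Qed.

Lemma cell_tops_exist (A : list tline) (h : pt) (k : tline -> Z) (p : pt) :
  lines_ok A -> spanning A -> generic A h -> open_cell A k p ->
  exists v0 v1, top A h k v1 /\ top A (vopp h) k v0.
Proof.
  intros ok sp G O. apply open_closed_cell in O.
  destruct (cell_top_exists A h k p ok sp G O) as [v1 T1].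
  destruct (cell_top_exists A (vopp h) k p ok sp (generic_vopp A h G) O) as [v0 T0].
  eauto.
Qed.

Lemma side_germ_not_top (A : list tline) (h : pt) (k : tline -> Z) (w v : pt) (b : bool) :
  h <> (0, 0) -> germ A k w (side b h) -> top A h k v \/ top A (vopp h) k v -> w <> v.
Proof.
  intros Nh Ge T <-. destruct (germ_point _ _ _ _ Ge) as (t & Ht & O).
  apply open_closed_cell in O.
  assert (N : vadd w t (side b h) <> w).
  { intro E. apply Nh. destruct w as [x y], h as [hx hy].
    destruct b; unfold vadd in E; simpl in E; injection E as Ex Ey; f_equal; nra. }
  destruct T as [(_ & _ & M)|(_ & _ & M)]; specialize (M _ O N);
    rewrite ?cross_vopp, cross_vadd, cross_side in M; lra.
Qed.

(** From [x] a small step inside the open cell lowers the functional strictly; descending further to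
    a vertex ends at a value that is still nonnegative. *)
Lemma cell_positive (A : list tline) (k : tline -> Z) (d : pt) (c : R) :
  lines_ok A -> spanning A -> d <> (0, 0) ->
  (forall v, closed_cell A k v -> crossing A v -> 0 <= cross d v + c) ->
  forall x, open_cell A k x -> 0 < cross d x + c.
Proof.
  intros ok sp Nd H x O.
  destruct (germ_point _ _ _ _ (germ_interior A k x (vopp (perp d)) O)) as (t & Ht & Ot).
  apply open_closed_cell in Ot.
  destruct (cell_vertex_above A k (vopp d) _ ok sp Ot) as (v & Cv & Xv & L).
  specialize (H v Cv Xv). rewrite !cross_vopp, cross_vadd in L.
  pose proof (cross_perp_pos d Nd).
  replace (cross d (vopp (perp d))) with (- cross d (perp d)) in L
    by (unfold cross, vopp, perp; simpl; ring).
  nra.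
Qed.

(* Barycentric coordinate of [x] at [P] in the triangle [P], [Q], [S]. *)
Definition bary (P Q S x : pt) : R :=
  cross (vsub S Q) (vsub x Q) / cross (vsub S Q) (vsub P Q).

Lemma noncollinear_rot (P1 P2 P3 : pt) : noncollinear P1 P2 P3 -> noncollinear P2 P3 P1.
Proof. unfold noncollinear; simpl. intros H E. apply H. lra. Qed.

Lemma bary_cancel (P Q S x : pt) :
  noncollinear P Q S ->
  bary P Q S x * ((fst Q - fst P) * (snd S - snd P) - (snd Q - snd P) * (fst S - fst P))
  = (fst Q - fst x) * (snd S - snd x) - (snd Q - snd x) * (fst S - fst x).
Proof.
  unfold noncollinear, bary, cross, vsub; simpl. intro N. field. intro E. apply N. lra.
Qed.

Lemma bary_affine (P Q S x : pt) (t : R) (y : pt) :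
  bary P Q S (vadd x t (vsub y x)) = bary P Q S x + t * (bary P Q S y - bary P Q S x).
Proof. unfold bary, cross, vsub, vadd, Rdiv; simpl. ring. Qed.

Lemma bary_decomp (P1 P2 P3 x : pt) :
  noncollinear P1 P2 P3 ->
  bary P1 P2 P3 x + bary P2 P3 P1 x + bary P3 P1 P2 x = 1 /\
  x = (bary P1 P2 P3 x * fst P1 + bary P2 P3 P1 x * fst P2 + bary P3 P1 P2 x * fst P3,
       bary P1 P2 P3 x * snd P1 + bary P2 P3 P1 x * snd P2 + bary P3 P1 P2 x * snd P3).
Proof.
  intro N. assert (N2 := noncollinear_rot _ _ _ N). assert (N3 := noncollinear_rot _ _ _ N2).
  pose proof (bary_cancel _ _ _ x N) as E1. pose proof (bary_cancel _ _ _ x N2) as E2.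
  pose proof (bary_cancel _ _ _ x N3) as E3.
  unfold noncollinear in N. clear N2 N3.
  set (b1 := bary P1 P2 P3 x) in *. set (b2 := bary P2 P3 P1 x) in *.
  set (b3 := bary P3 P1 P2 x) in *. clearbody b1 b2 b3.
  destruct x as [x y], P1 as [x1 y1], P2 as [x2 y2], P3 as [x3 y3]; simpl in *.
  set (D := (x2 - x1) * (y3 - y1) - (y2 - y1) * (x3 - x1)) in *.
  replace ((x3 - x2) * (y1 - y2) - (y3 - y2) * (x1 - x2)) with D in E2 by (unfold D; ring).
  replace ((x1 - x3) * (y2 - y3) - (y1 - y3) * (x2 - x3)) with D in E3 by (unfold D; ring).
  split; [|f_equal]; apply (Rmult_eq_reg_r D); auto.
  - rewrite !Rmult_plus_distr_r, E1, E2, E3. unfold D; ring.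
  - replace ((b1 * x1 + b2 * x2 + b3 * x3) * D)
      with (x1 * (b1 * D) + x2 * (b2 * D) + x3 * (b3 * D)) by ring.
    rewrite E1, E2, E3. unfold D; ring.
  - replace ((b1 * y1 + b2 * y2 + b3 * y3) * D)
      with (y1 * (b1 * D) + y2 * (b2 * D) + y3 * (b3 * D)) by ring.
    rewrite E1, E2, E3. unfold D; ring.
Qed.

Lemma bary_at (P Q S : pt) (a b c : R) :
  noncollinear P Q S -> a + b + c = 1 ->
  bary P Q S (a * fst P + b * fst Q + c * fst S, a * snd P + b * snd Q + c * snd S) = a.
Proof.
  intros N E. replace c with (1 - a - b) by lra.
  unfold noncollinear, bary, cross, vsub in *; simpl. field. intro Z. apply N. lra.
Qed.

Lemma open_triangle_bary (P1 P2 P3 x : pt) :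
  noncollinear P1 P2 P3 ->
  (open_triangle P1 P2 P3 x <->
   0 < bary P1 P2 P3 x /\ 0 < bary P2 P3 P1 x /\ 0 < bary P3 P1 P2 x).
Proof.
  intro N. assert (N2 := noncollinear_rot _ _ _ N). assert (N3 := noncollinear_rot _ _ _ N2).
  split.
  - intros (a & b & c & Ha & Hb & Hc & S & ->).
    rewrite (bary_at P1 P2 P3 a b c N S).
    replace (a * fst P1 + b * fst P2 + c * fst P3) with
      (b * fst P2 + c * fst P3 + a * fst P1) by ring.
    replace (a * snd P1 + b * snd P2 + c * snd P3) with
      (b * snd P2 + c * snd P3 + a * snd P1) by ring.
    rewrite (bary_at P2 P3 P1 b c a N2) by lra.
    replace (b * fst P2 + c * fst P3 + a * fst P1) with
      (c * fst P3 + a * fst P1 + b * fst P2) by ring.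
    replace (b * snd P2 + c * snd P3 + a * snd P1) with
      (c * snd P3 + a * snd P1 + b * snd P2) by ring.
    rewrite (bary_at P3 P1 P2 c a b N3) by lra. auto.
  - intros (H1 & H2 & H3). destruct (bary_decomp P1 P2 P3 x N) as [S E].
    exists (bary P1 P2 P3 x), (bary P2 P3 P1 x), (bary P3 P1 P2 x). auto 7.
Qed.

Lemma bary_self (P Q S : pt) : noncollinear P Q S -> bary P Q S P = 1.
Proof.
  intro N. unfold bary, noncollinear, cross, vsub in *; simpl in *. field. intro E. apply N. lra.
Qed.

Lemma bary_other1 (P Q S : pt) : bary P Q S Q = 0.
Proof. unfold bary, cross, vsub, Rdiv; simpl. ring. Qed.

Lemma bary_other2 (P Q S : pt) : bary P Q S S = 0.
Proof. unfold bary, cross, vsub, Rdiv; simpl. ring. Qed.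

Lemma lval_convex (l : tline) (a b c : R) (P1 P2 P3 : pt) :
  a + b + c = 1 ->
  lval l (a * fst P1 + b * fst P2 + c * fst P3, a * snd P1 + b * snd P2 + c * snd P3)
  = a * lval l P1 + b * lval l P2 + c * lval l P3.
Proof.
  intro E. destruct l as [[p q] r]; simpl.
  replace c with (1 - a - b) by lra. ring.
Qed.

Lemma ok_not_constant (l : tline) (P1 P2 P3 : pt) :
  tline_ok l -> noncollinear P1 P2 P3 ->
  lval l P1 = lval l P2 -> lval l P1 = lval l P3 -> False.
Proof.
  destruct l as [[a b] c]; unfold noncollinear; simpl. intros G N E2 E3.
  set (D := (fst P2 - fst P1) * (snd P3 - snd P1) - (snd P2 - snd P1) * (fst P3 - fst P1)) in *.
  assert (Za : IZR a * D = 0).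
  { replace (IZR a * D) with
      ((IZR a * (fst P2 - fst P1) + IZR b * (snd P2 - snd P1)) * (snd P3 - snd P1)
       - (IZR a * (fst P3 - fst P1) + IZR b * (snd P3 - snd P1)) * (snd P2 - snd P1))
      by (unfold D; ring).
    replace (IZR a * (fst P2 - fst P1) + IZR b * (snd P2 - snd P1)) with 0 by lra.
    replace (IZR a * (fst P3 - fst P1) + IZR b * (snd P3 - snd P1)) with 0 by lra. ring. }
  assert (Zb : IZR b * D = 0).
  { replace (IZR b * D) with
      ((IZR a * (fst P3 - fst P1) + IZR b * (snd P3 - snd P1)) * (fst P2 - fst P1)
       - (IZR a * (fst P2 - fst P1) + IZR b * (snd P2 - snd P1)) * (fst P3 - fst P1))
      by (unfold D; ring).
    replace (IZR a * (fst P2 - fst P1) + IZR b * (snd P2 - snd P1)) with 0 by lra.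
    replace (IZR a * (fst P3 - fst P1) + IZR b * (snd P3 - snd P1)) with 0 by lra. ring. }
  destruct (Rmult_integral _ _ Za) as [Ea|]; [|contradiction].
  destruct (Rmult_integral _ _ Zb) as [Eb|]; [|contradiction].
  apply eq_IZR in Ea, Eb. subst. discriminate.
Qed.

Lemma convex_comb_gt (a b c x y z lo : R) :
  0 < a -> 0 < b -> 0 < c -> a + b + c = 1 -> lo <= x -> lo <= y -> lo <= z ->
  ~ (x = y /\ x = z) -> lo < a * x + b * y + c * z.
Proof.
  intros Ha Hb Hc S Hx Hy Hz N.
  assert (Q : lo < x \/ lo < y \/ lo < z).
  { destruct Hx; [auto|]. destruct Hy; [auto|]. destruct Hz; [auto|]. exfalso. apply N. lra. }
  replace c with (1 - a - b) in * by lra.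
  assert (0 <= a * (x - lo)) by nra. assert (0 <= b * (y - lo)) by nra.
  assert (0 <= (1 - a - b) * (z - lo)) by nra.
  destruct Q as [Q|[Q|Q]].
  - assert (0 < a * (x - lo)) by nra. lra.
  - assert (0 < b * (y - lo)) by nra. lra.
  - assert (0 < (1 - a - b) * (z - lo)) by nra. lra.
Qed.

Lemma bary_cell_positive (A : list tline) (k : tline -> Z) (P Q S x : pt) :
  lines_ok A -> spanning A -> noncollinear P Q S ->
  (forall v, closed_cell A k v -> crossing A v -> 0 <= bary P Q S v) ->
  open_cell A k x -> 0 < bary P Q S x.
Proof.
  intros ok sp N H O.
  set (D := cross (vsub S Q) (vsub P Q)).
  assert (ND : D <> 0).
  { unfold D, noncollinear, cross, vsub in *; simpl in *. intro E. apply N. lra. }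
  set (d := ((fst S - fst Q) / D, (snd S - snd Q) / D)).
  assert (E : forall y, bary P Q S y = cross d y + - cross d Q).
  { intro y. unfold bary. fold D. unfold d, cross, vsub; simpl. field. auto. }
  rewrite E. apply (cell_positive A k d); auto.
  - intro Z. apply ND. unfold d in Z. injection Z as Zx Zy.
    assert (Zx' : fst S - fst Q = 0)
      by (apply (Rmult_eq_reg_r (/ D)); [unfold Rdiv in Zx; lra|];
          apply Rinv_neq_0_compat; auto).
    assert (Zy' : snd S - snd Q = 0)
      by (apply (Rmult_eq_reg_r (/ D)); [unfold Rdiv in Zy; lra|];
          apply Rinv_neq_0_compat; auto).
    unfold D, cross, vsub; simpl. rewrite Zx', Zy'. ring.
  - intros v Cv Xv. rewrite <- E. auto.
Qed.

(** Each barycentric coordinate is nonnegative at all vertices of the cell, hence positive inside.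
    Conversely the strip bounds at the corners become strict inside the triangle, since [lval l] is
    not constant on noncollinear points. *)
Lemma cell_triangle (A : list tline) (k : tline -> Z) (P1 P2 P3 : pt) :
  lines_ok A -> spanning A -> noncollinear P1 P2 P3 ->
  closed_cell A k P1 -> closed_cell A k P2 -> closed_cell A k P3 ->
  (forall v, closed_cell A k v -> crossing A v -> v = P1 \/ v = P2 \/ v = P3) ->
  forall x, open_cell A k x <-> open_triangle P1 P2 P3 x.
Proof.
  intros ok sp N C1 C2 C3 V x.
  assert (N2 := noncollinear_rot _ _ _ N). assert (N3 := noncollinear_rot _ _ _ N2).
  split.
  - intro O. apply open_triangle_bary; auto.
    split; [|split]; apply (bary_cell_positive A k); auto; intros v Cv Xv;
      destruct (V v Cv Xv) as [->|[->| ->]];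
      rewrite ?bary_self, ?bary_other1, ?bary_other2 by auto; lra.
  - intros (a & b & c & Ha & Hb & Hc & S & ->) l Hl.
    rewrite lval_convex by auto.
    assert (NC : ~ (lval l P1 = lval l P2 /\ lval l P1 = lval l P3)).
    { intros [E2 E3]. apply (ok_not_constant l P1 P2 P3); auto. }
    specialize (C1 l Hl). specialize (C2 l Hl). specialize (C3 l Hl).
    split; [apply convex_comb_gt; lra|].
    assert (- (IZR (k l) + 1) < a * (- lval l P1) + b * (- lval l P2) + c * (- lval l P3))
      by (apply convex_comb_gt; lra).
    lra.
Qed.

Lemma triangle_centroid (P1 P2 P3 : pt) : exists p, open_triangle P1 P2 P3 p.
Proof.
  eexists. exists (/ 3), (/ 3), (/ 3). repeat split; lra.
Qed.

Lemma nonneg_of_segment (x y : R) :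
  (forall t, 0 < t < 1 -> 0 < x + t * (y - x)) -> 0 <= x.
Proof.
  intro H. apply Rnot_lt_le. intro L.
  (* For negative [x] the parameter - x / M lies in (0, 1) and makes x + t (y - x) negative. *)
  set (M := Rabs (y - x) - x + 1).
  assert (HM : 0 < M) by (unfold M; pose proof (Rabs_pos (y - x)); lra).
  assert (Ht : 0 < - x / M) by (apply Rdiv_lt_0_compat; lra).
  assert (E : - x / M * M = - x) by (field; lra).
  set (t := - x / M) in *. clearbody t.
  assert (B := Rle_abs (y - x)). pose proof (Rabs_pos (y - x)).
  assert (t < 1) by (unfold M in E; nra).
  specialize (H t ltac:(lra)).
  assert (t * (y - x) <= t * Rabs (y - x)) by (apply Rmult_le_compat_l; lra).
  unfold M in E. nra.
Qed.

(** A vertex with two positive barycentric coordinates could move both ways parallel to the side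
    joining those two corners, which [crossing_extreme] forbids; so a single coordinate is
    nonzero. *)
Lemma triangle_cell_vertices (A : list tline) (k : tline -> Z) (P1 P2 P3 : pt) :
  noncollinear P1 P2 P3 ->
  (forall x, open_cell A k x <-> open_triangle P1 P2 P3 x) ->
  forall w, closed_cell A k w -> crossing A w -> w = P1 \/ w = P2 \/ w = P3.
Proof.
  intros N H w Cw Xw.
  assert (N2 := noncollinear_rot _ _ _ N). assert (N3 := noncollinear_rot _ _ _ N2).
  destruct (triangle_centroid P1 P2 P3) as [p Tp].
  assert (Op : open_cell A k p) by (apply H; auto).
  assert (Tp' := Tp). apply open_triangle_bary in Tp'; auto. destruct Tp' as (B1 & B2 & B3).
  assert (CP : forall P, 0 <= bary P1 P2 P3 P -> 0 <= bary P2 P3 P1 P ->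
     0 <= bary P3 P1 P2 P -> closed_cell A k P).
  { intros P Q1 Q2 Q3. apply (closed_cell_limit A k P (vsub p P) 1); [lra|].
    intros t Ht. apply open_closed_cell, H, open_triangle_bary; auto.
    rewrite !bary_affine. repeat split; nra. }
  assert (W : 0 <= bary P1 P2 P3 w /\ 0 <= bary P2 P3 P1 w /\ 0 <= bary P3 P1 P2 w).
  { assert (Seg : forall t, 0 < t < 1 -> open_triangle P1 P2 P3 (vadd w t (vsub p w)))
      by (intros t Ht; apply H; apply open_cell_segment; auto; lra).
    split; [|split].
    - apply (nonneg_of_segment _ (bary P1 P2 P3 p)). intros t Ht.
      specialize (Seg t Ht). apply open_triangle_bary in Seg; auto.
      rewrite <- bary_affine. tauto.
    - apply (nonneg_of_segment _ (bary P2 P3 P1 p)). intros t Ht.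
      specialize (Seg t Ht). apply open_triangle_bary in Seg; auto.
      rewrite <- bary_affine. tauto.
    - apply (nonneg_of_segment _ (bary P3 P1 P2 p)). intros t Ht.
      specialize (Seg t Ht). apply open_triangle_bary in Seg; auto.
      rewrite <- bary_affine. tauto. }
  destruct W as (W1 & W2 & W3).
  destruct (bary_decomp P1 P2 P3 w N) as [S E].
  set (b1 := bary P1 P2 P3 w) in *. set (b2 := bary P2 P3 P1 w) in *.
  set (b3 := bary P3 P1 P2 w) in *.
  assert (K1 : closed_cell A k P1).
  { apply CP; rewrite ?bary_self, ?bary_other1, ?bary_other2 by auto; lra. }
  assert (K2 : closed_cell A k P2).
  { apply CP; rewrite ?bary_self, ?bary_other1, ?bary_other2 by auto; lra. }
  assert (K3 : closed_cell A k P3).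
  { apply CP; rewrite ?bary_self, ?bary_other1, ?bary_other2 by auto; lra. }
  assert (Tri : forall a b c, 0 <= a -> 0 <= b -> 0 <= c -> a + b + c = 1 ->
    closed_cell A k (a * fst P1 + b * fst P2 + c * fst P3,
                     a * snd P1 + b * snd P2 + c * snd P3)).
  { intros a b c Ha Hb Hc Sm l Hl. rewrite lval_convex by auto.
    specialize (K1 l Hl). specialize (K2 l Hl). specialize (K3 l Hl).
    replace c with (1 - a - b) in * by lra. split; nra. }
  assert (NE : forall P Q, vsub Q P = (0, 0) -> fst Q = fst P /\ snd Q = snd P).
  { intros P Q Z. apply vsub_zero in Z. rewrite Z; auto. }
  clearbody b1 b2 b3.
  destruct (Req_dec b1 0) as [Z1|Z1]; destruct (Req_dec b2 0) as [Z2|Z2].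
  - right; right. rewrite E, Z1, Z2. replace b3 with 1 by lra. destruct P3; simpl; f_equal; ring.
  - destruct (Req_dec b3 0) as [Z3|Z3].
    + right; left. rewrite E, Z1, Z3. replace b2 with 1 by lra. destruct P2; simpl; f_equal; ring.
    + exfalso. assert (Z : vsub P3 P2 = (0, 0)).
      (* Moving by [b2] or by [- b3] along this side transfers the whole weight of one corner to the
         other. *)
      { apply (crossing_extreme A k w (vsub P3 P2) b2 b3); auto; try lra.
        - rewrite E at 1. generalize (Tri b1 0 (b2 + b3)). intro T.
          replace (vadd _ _ _) with (b1 * fst P1 + 0 * fst P2 + (b2 + b3) * fst P3,
            b1 * snd P1 + 0 * snd P2 + (b2 + b3) * snd P3)
            by (unfold vadd, vsub; simpl; f_equal; ring). apply T; lra.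
        - rewrite E at 1. generalize (Tri b1 (b2 + b3) 0). intro T.
          replace (vadd _ _ _) with (b1 * fst P1 + (b2 + b3) * fst P2 + 0 * fst P3,
            b1 * snd P1 + (b2 + b3) * snd P2 + 0 * snd P3)
            by (unfold vadd, vsub; simpl; f_equal; ring). apply T; lra. }
      apply NE in Z as [Zx Zy]. apply N. rewrite Zx, Zy. ring.
  - destruct (Req_dec b3 0) as [Z3|Z3].
    + left. rewrite E, Z2, Z3. replace b1 with 1 by lra. destruct P1; simpl; f_equal; ring.
    + exfalso. assert (Z : vsub P3 P1 = (0, 0)).
      { apply (crossing_extreme A k w (vsub P3 P1) b1 b3); auto; try lra.
        - rewrite E at 1. generalize (Tri 0 b2 (b1 + b3)). intro T.
          replace (vadd _ _ _) with (0 * fst P1 + b2 * fst P2 + (b1 + b3) * fst P3,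
            0 * snd P1 + b2 * snd P2 + (b1 + b3) * snd P3)
            by (unfold vadd, vsub; simpl; f_equal; ring). apply T; lra.
        - rewrite E at 1. generalize (Tri (b1 + b3) b2 0). intro T.
          replace (vadd _ _ _) with ((b1 + b3) * fst P1 + b2 * fst P2 + 0 * fst P3,
            (b1 + b3) * snd P1 + b2 * snd P2 + 0 * snd P3)
            by (unfold vadd, vsub; simpl; f_equal; ring). apply T; lra. }
      apply NE in Z as [Zx Zy]. apply N. rewrite Zx, Zy. ring.
  - exfalso. assert (Z : vsub P2 P1 = (0, 0)).
    { apply (crossing_extreme A k w (vsub P2 P1) b1 b2); auto; try lra.
      - rewrite E at 1. generalize (Tri 0 (b1 + b2) b3). intro T.
        replace (vadd _ _ _) with (0 * fst P1 + (b1 + b2) * fst P2 + b3 * fst P3,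
          0 * snd P1 + (b1 + b2) * snd P2 + b3 * snd P3)
          by (unfold vadd, vsub; simpl; f_equal; ring). apply T; lra.
      - rewrite E at 1. generalize (Tri (b1 + b2) 0 b3). intro T.
        replace (vadd _ _ _) with ((b1 + b2) * fst P1 + 0 * fst P2 + b3 * fst P3,
          (b1 + b2) * snd P1 + 0 * snd P2 + b3 * snd P3)
          by (unfold vadd, vsub; simpl; f_equal; ring). apply T; lra. }
    apply NE in Z as [Zx Zy]. apply N. rewrite Zx, Zy. ring.
Qed.

(** * Counting *)

Lemma pigeonhole_rel {X Y : Type} (lx : list X) (ly : list Y) (Rel : X -> Y -> Prop) :
  NoDup lx -> (forall x, In x lx -> exists y, In y ly /\ Rel x y) ->
  (forall x x' y, In x lx -> In x' lx -> Rel x y -> Rel x' y -> x = x') ->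
  (length lx <= length ly)%nat.
Proof.
  revert ly. induction lx as [|x lx IH]; intros ly ND T U; [simpl; lia|].
  apply NoDup_cons_iff in ND as [Nx ND].
  destruct (T x (or_introl eq_refl)) as (y & Hy & Rxy).
  destruct (in_split y ly Hy) as (l1 & l2 & ->).
  rewrite length_app. simpl.
  assert (L : (length lx <= length (l1 ++ l2))%nat).
  { apply IH; auto.
    - intros x' Hx'. destruct (T x' (or_intror Hx')) as (y' & Hy' & Rxy').
      exists y'. split; auto. apply in_app_iff in Hy'. apply in_app_iff.
      destruct Hy' as [|[<-|]]; auto. exfalso. apply Nx.
      rewrite (U x x' y); auto; [left|right]; auto.
    - intros a b c Ha Hb. apply U; right; auto. }
  rewrite length_app in L. lia.
Qed.

(** [y2] can be deleted from [ly], because whatever is related to it is also related to [y1]. *)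
Lemma pigeonhole_rel_strict {X Y : Type} (lx : list X) (ly : list Y) (Rel : X -> Y -> Prop)
    (y1 y2 : Y) :
  NoDup lx -> (forall x, In x lx -> exists y, In y ly /\ Rel x y) ->
  (forall x x' y, In x lx -> In x' lx -> Rel x y -> Rel x' y -> x = x') ->
  In y1 ly -> In y2 ly -> y1 <> y2 -> (forall x, In x lx -> Rel x y2 -> Rel x y1) ->
  (length lx < length ly)%nat.
Proof.
  intros ND T U H1 H2 N I. destruct (in_split y2 ly H2) as (l1 & l2 & ->).
  assert (H1' : In y1 (l1 ++ l2)).
  { apply in_app_iff in H1. apply in_app_iff. destruct H1 as [|[E|]]; auto.
    exfalso; apply N; auto. }
  rewrite length_app. simpl.
  assert (L : (length lx <= length (l1 ++ l2))%nat).
  { apply (pigeonhole_rel lx (l1 ++ l2) Rel); auto.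
    intros x Hx. destruct (T x Hx) as (y & Hy & Rxy).
    apply in_app_iff in Hy. destruct Hy as [Hy|[<-|Hy]].
    - exists y. split; auto. apply in_app_iff; auto.
    - exists y1. auto.
    - exists y. split; auto. apply in_app_iff; auto. }
  rewrite length_app in L. lia.
Qed.

Lemma NoDup_prod {X Y : Type} (l : list X) (l' : list Y) :
  NoDup l -> NoDup l' -> NoDup (list_prod l l').
Proof.
  intros H H'. induction H as [|x l Nx H IH]; simpl; [constructor|].
  apply NoDup_app; auto.
  - apply NoDup_map_NoDup_ForallPairs; auto. intros y y' _ _ E. injection E; auto.
  - intros [x' y] Hm Hp. apply in_map_iff in Hm as (y' & E & _). injection E as -> ->.
    apply in_prod_iff in Hp. tauto.
Qed.

(** Replaces separation by indices with absence of duplicates and separation by membership, the form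
    used in pigeonhole arguments. *)
Lemma card_classes_reps (P : pt -> Prop) (E : pt -> pt -> Prop) (n : nat) :
  (forall x, P x -> E x x) -> (forall x y, E x y -> E y x) -> card_classes P E n ->
  exists l, length l = n /\ NoDup l /\ (forall x, In x l -> P x) /\
    (forall x y, In x l -> In y l -> E x y -> x = y) /\
    (forall x, P x -> exists y, In y l /\ E x y).
Proof.
  intros Rf Sy (l & L & HP & D & T). exists l. split; auto.
  assert (U : forall i j, (i < n)%nat -> (j < n)%nat ->
    E (nth i l (0, 0)) (nth j l (0, 0)) -> i = j).
  { intros i j Hi Hj HE. destruct (Nat.lt_trichotomy i j) as [Lt|[Eq|Lt]]; auto; exfalso.
    - apply (D i j); auto.
    - apply (D j i); auto. }
  split; [|split; [auto|split; [|auto]]].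
  - apply (NoDup_nth l (0, 0)). intros i j Hi Hj Eq. rewrite L in *.
    apply U; auto. rewrite Eq. apply Rf. apply HP. apply nth_In. lia.
  - intros x y Hx Hy HE.
    destruct (In_nth l x (0, 0) Hx) as (i & Hi & <-).
    destruct (In_nth l y (0, 0) Hy) as (j & Hj & <-).
    rewrite L in *. rewrite (U i j); auto.
Qed.

(** * Representatives of chambers and integer translations of cells *)

Lemma same_chamber_sym (A : list tline) (p q : pt) : same_chamber A p q -> same_chamber A q p.
Proof. intros (S & H1 & H2 & H3 & H4 & H5). exists S. auto 6. Qed.

Lemma same_chamber_refl (A : list tline) (p : pt) :
  lines_ok A -> compl A p -> same_chamber A p p.
Proof.
  intros ok C. apply same_chamber_iff; auto. split; auto. exists 0%Z, 0%Z.
  rewrite shift_0. apply open_cell_floors; auto.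
Qed.

Lemma shifted_floors (A : list tline) (k : tline -> Z) (c : pt) (m n : Z) :
  lines_ok A -> open_cell A k (shift c m n) ->
  compl A c /\ forall l, In l A -> k l = kshift (floors c) m n l.
Proof.
  intros ok O.
  assert (C : compl A c).
  { rewrite <- (shift_opp c m n). apply compl_shift; auto. apply (open_cell_compl A k); auto. }
  split; auto. apply (open_cell_unique A _ _ (shift c m n)); auto.
  apply open_cell_shift. apply open_cell_floors; auto.
Qed.

Lemma chamber_rep (A : list tline) (lc : list pt) (k : tline -> Z) (p : pt) :
  lines_ok A -> (forall x, compl A x -> exists y, In y lc /\ same_chamber A x y) ->
  open_cell A k p ->
  exists c m n, In c lc /\ forall l, In l A -> k l = kshift (floors c) m n l.
Proof.
  intros ok T O. assert (C := open_cell_compl A k p ok O).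
  destruct (T p C) as (c & Hc & S). apply same_chamber_iff in S; auto.
  destruct S as (_ & m & n & Oc). exists c, m, n. split; auto.
  destruct (shifted_floors A (floors p) c m n ok Oc) as [_ E].
  intros l Hl. rewrite <- E by auto.
  apply (open_cell_unique A k (floors p) p); auto. apply open_cell_floors; auto.
Qed.

Lemma same_chamber_of_floors (A : list tline) (c c' : pt) (m n : Z) :
  lines_ok A -> compl A c -> compl A c' ->
  (forall l, In l A -> floors c l = kshift (floors c') m n l) -> same_chamber A c c'.
Proof.
  intros ok C C' E. apply same_chamber_iff; auto. split; auto. exists m, n.
  apply (open_cell_ext A (kshift (floors c') m n)); [intros; symmetry; auto|].
  apply open_cell_shift. apply open_cell_floors; auto.
Qed.

Lemma kshift_unshift (k : tline -> Z) (m n : Z) (l : tline) :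
  kshift (kshift k m n) (- m) (- n) l = k l.
Proof. unfold kshift. lia. Qed.

Lemma top_unshift (A : list tline) (h : pt) (k k' : tline -> Z) (v : pt) (m n : Z) :
  (forall l, In l A -> k l = kshift k' m n l) ->
  top A h k v -> top A h k' (shift v (- m) (- n)).
Proof.
  intros E T. apply (top_ext A h (kshift (kshift k' m n) (- m) (- n)));
    [intros; apply kshift_unshift|].
  apply top_shift. apply (top_ext A h k); auto.
Qed.

Lemma germ_shift (A : list tline) (k : tline -> Z) (v u : pt) (m n : Z) :
  germ A k v u -> germ A (kshift k m n) (shift v m n) u.
Proof.
  intros (e & He & P). exists e. split; auto. intros t Ht. rewrite vadd_shift.
  apply open_cell_shift. auto.
Qed.

Lemma germ_unshift (A : list tline) (k k' : tline -> Z) (v u : pt) (m n : Z) :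
  (forall l, In l A -> k l = kshift k' m n l) ->
  germ A k v u -> germ A k' (shift v (- m) (- n)) u.
Proof.
  intros E T. apply (germ_ext A (kshift (kshift k' m n) (- m) (- n)));
    [intros; apply kshift_unshift|].
  apply germ_shift. apply (germ_ext A k); auto.
Qed.

Definition top_of (A : list tline) (h v c : pt) : Prop :=
  exists m n, top A h (floors c) (shift v m n).

(** The chamber of [c] is what one sees from the torus point of [fst x] along [h] for [true] and
    along [- h] for [false]. *)
Definition beside (A : list tline) (h c : pt) (x : pt * bool) : Prop :=
  exists m n, germ A (floors c) (shift (fst x) m n) (side (snd x) h).

Lemma top_of_unique (A : list tline) (h v v' c : pt) :
  top_of A h v c -> top_of A h v' c -> torus_eq v v'.
Proof.
  intros (m & n & T) (m' & n' & T'). assert (E := top_unique _ _ _ _ _ T T').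
  exists (m + - m')%Z, (n + - n')%Z. rewrite <- shift_shift, E, shift_opp. reflexivity.
Qed.

Lemma top_of_torus_eq (A : list tline) (h v v' c : pt) :
  torus_eq v v' -> top_of A h v' c -> top_of A h v c.
Proof.
  intros (m & n & ->) (m' & n' & T). rewrite shift_shift in T. exists (m + m')%Z, (n + n')%Z. auto.
Qed.

Lemma beside_torus_eq (A : list tline) (h v v' c : pt) (b : bool) :
  torus_eq v v' -> beside A h c (v', b) -> beside A h c (v, b).
Proof.
  intros (m & n & ->) (m' & n' & T). simpl in T. rewrite shift_shift in T.
  exists (m + m')%Z, (n + n')%Z. auto.
Qed.

(** A point and a direction determine the cell of the germ; translating the second cell makes both
    germs start at the same lift of the vertex. *)
Lemma beside_same_chamber (A : list tline) (h c c' : pt) (x : pt * bool) :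
  lines_ok A -> compl A c -> compl A c' ->
  beside A h c x -> beside A h c' x -> same_chamber A c c'.
Proof.
  intros ok C C' (m & n & G) (m' & n' & G').
  apply (germ_shift A _ _ _ (m + - m') (n + - n')) in G'.
  rewrite shift_shift in G'. replace (m' + (m + - m'))%Z with m in G' by ring.
  replace (n' + (n + - n'))%Z with n in G' by ring.
  apply (same_chamber_of_floors A c c' (m + - m') (n + - n')); auto.
  apply (germ_unique A _ _ (shift (fst x) m n) (side (snd x) h)); auto.
Qed.

Lemma beside_exists (A : list tline) (h c : pt) :
  lines_ok A -> spanning A -> generic A h -> compl A c ->
  exists w b, crossing A w /\ germ A (floors c) w (side b h).
Proof.
  intros ok sp G C. assert (O := open_cell_floors A c ok C).
  destruct (cell_tops_exist A h _ c ok sp G O) as (v0 & v1 & T1 & T0).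
  destruct (middle_vertex_exists A h _ v0 v1 c ok sp G O T1 T0) as (w & X & Cw & N0 & N1).
  destruct (middle_vertex_germ A h _ v0 v1 w sp G T1 T0 X Cw N0 N1) as [[b Gb] _].
  eauto.
Qed.

Lemma list_prod_bool_length (lv : list pt) :
  length (list_prod lv (true :: false :: nil)) = (2 * length lv)%nat.
Proof. rewrite length_prod. simpl. lia. Qed.

Lemma num_vertices_reps (A : list tline) (n : nat) :
  arrangement A -> num_vertices A n ->
  exists l, length l = n /\ NoDup l /\ (forall x, In x l -> crossing A x) /\
    (forall x y, In x l -> In y l -> torus_eq x y -> x = y) /\
    (forall x, crossing A x -> exists y, In y l /\ torus_eq x y).
Proof.
  intros ar H. destruct (card_classes_reps _ _ _ (fun x _ => torus_eq_refl x) torus_eq_sym H)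
    as (l & L & ND & HP & U & T).
  exists l. split; [auto|]. split; [auto|].
  split; [intros x Hx; apply vertex_iff; auto|]. split; [auto|].
  intros x Hx. apply T. apply vertex_iff; auto.
Qed.

Lemma num_chambers_reps (A : list tline) (n : nat) :
  lines_ok A -> num_chambers A n ->
  exists l, length l = n /\ NoDup l /\ (forall x, In x l -> compl A x) /\
    (forall x y, In x l -> In y l -> same_chamber A x y -> x = y) /\
    (forall x, compl A x -> exists y, In y l /\ same_chamber A x y).
Proof.
  intros ok H. apply card_classes_reps; auto.
  - intros; apply same_chamber_refl; auto.
  - apply same_chamber_sym.
Qed.

Lemma vertices_le_chambers (A : list tline) (f0 f2 : nat) :
  arrangement A -> num_vertices A f0 -> num_chambers A f2 ->
  (f0 <= f2)%nat /\ (f2 = f0 -> simple A).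
Proof.
  intros ar HV HC. assert (ok := arrangement_lines_ok A ar).
  assert (sp := arrangement_spanning A ar). destruct (generic_exists A ok) as [h G].
  destruct (num_vertices_reps A f0 ar HV) as (lv & Lv & NDv & Pv & Uv & Tv).
  destruct (num_chambers_reps A f2 ok HC) as (lc & Lc & NDc & Pc & Uc & Tc).
  assert (T : forall v, In v lv -> exists c, In c lc /\ top_of A h v c).
  { intros v Hv. destruct (top_cell_exists A h v sp G (Pv v Hv)) as (k & p & O & Tp).
    destruct (chamber_rep A lc k p ok Tc O) as (c & m & n & Hc & E).
    exists c. split; auto. exists (- m)%Z, (- n)%Z. apply (top_unshift A h k); auto. }
  assert (U : forall v v' c, In v lv -> In v' lv -> top_of A h v c -> top_of A h v' c -> v = v').
  { intros v v' c Hv Hv' Q Q'. apply Uv; auto. apply (top_of_unique A h v v' c); auto. }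
  split.
  - rewrite <- Lv, <- Lc. apply (pigeonhole_rel lv lc (top_of A h)); auto.
  - intro Eq. apply simple_iff; auto. intros v Tr.
    destruct (triple_point_top_cells A h v sp G Tr)
      as (k & p & k' & p' & O & O' & Tp & Tp' & NE).
    destruct (chamber_rep A lc k p ok Tc O) as (c & m & n & Hc & E).
    destruct (chamber_rep A lc k' p' ok Tc O') as (c' & m' & n' & Hc' & E').
    assert (Q := top_unshift A h k _ v m n E Tp).
    assert (Q' := top_unshift A h k' _ v m' n' E' Tp').
    (* If both cells were translates of the cell of one [c], its unique highest vertex would force
       equal translations and hence equal labels. *)
    assert (Nc : c <> c').
    { intros <-. assert (Z := top_unique _ _ _ _ _ Q Q').
      apply NE. intros l Hl. rewrite E, E' by auto. unfold shift in Z.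
      injection Z as Zx Zy. rewrite !opp_IZR in *.
      assert (IZR m = IZR m') by lra. assert (IZR n = IZR n') by lra.
      replace m' with m by (apply eq_IZR; auto). replace n' with n by (apply eq_IZR; auto).
      reflexivity. }
    (* [c'] is a redundant target: a vertex on top of it is a translate of [v], which is also on top
       of [c]. *)
    assert (length lv < length lc)%nat; [|lia].
    apply (pigeonhole_rel_strict lv lc (top_of A h) c c'); auto.
    intros x Hx Rx. apply (top_of_torus_eq A h x v).
    + apply (top_of_unique A h x v c'); auto. exists (- m')%Z, (- n')%Z. auto.
    + exists (- m)%Z, (- n)%Z. auto.
Qed.

(** At double points the highest vertex determines the chamber, so the same relation read backwards
    injects chambers into vertices. *)
Lemma simple_chambers_le_vertices (A : list tline) (f0 f2 : nat) :
  arrangement A -> num_vertices A f0 -> num_chambers A f2 -> simple A -> (f2 <= f0)%nat.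
Proof.
  intros ar HV HC S. assert (ok := arrangement_lines_ok A ar).
  assert (sp := arrangement_spanning A ar). destruct (generic_exists A ok) as [h G].
  destruct (num_vertices_reps A f0 ar HV) as (lv & Lv & NDv & Pv & Uv & Tv).
  destruct (num_chambers_reps A f2 ok HC) as (lc & Lc & NDc & Pc & Uc & Tc).
  assert (NT := proj1 (simple_iff A ar) S).
  rewrite <- Lv, <- Lc. apply (pigeonhole_rel lc lv (fun c v => top_of A h v c)); auto.
  - intros c Hc. assert (O := open_cell_floors A c ok (Pc c Hc)).
    destruct (cell_top_exists A h _ c ok sp G (open_closed_cell _ _ _ O)) as [v Tp].
    destruct (Tv v (proj1 (proj2 Tp))) as (v' & Hv' & E).
    exists v'. split; auto. apply (top_of_torus_eq A h v' v).
    + apply torus_eq_sym; auto.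
    + exists 0%Z, 0%Z. rewrite shift_0. auto.
  - intros c c' v Hc Hc' (m & n & T) (m' & n' & T'). apply Uc; auto.
    assert (O := open_cell_floors A c ok (Pc c Hc)).
    assert (O' := open_cell_floors A c' ok (Pc c' Hc')).
    apply (top_shift A h _ _ (m + - m') (n + - n')) in T'.
    rewrite shift_shift in T'. replace (m' + (m + - m'))%Z with m in T' by ring.
    replace (n' + (n + - n'))%Z with n in T' by ring.
    apply (same_chamber_of_floors A c c' (m + - m') (n + - n')); auto.
    apply (double_point_top_unique A h _ _ (shift v m n) c (shift c' (m + - m') (n + - n')));
      auto.
    apply open_cell_shift. auto.
Qed.

(** * Toric triangles and triangular cells *)

Lemma toric_triangle_of_cell (A : list tline) (h p P1 P2 P3 : pt) :
  lines_ok A -> spanning A -> generic A h -> compl A p -> noncollinear P1 P2 P3 ->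
  (forall x, open_cell A (floors p) x <-> open_triangle P1 P2 P3 x) ->
  toric_triangle (chamber A p).
Proof.
  intros ok sp G C N T. exists P1, P2, P3. split; auto. cbv zeta.
  assert (Inj : forall s t, open_triangle P1 P2 P3 s -> open_triangle P1 P2 P3 t ->
     torus_eq s t -> s = t).
  { intros s t Hs Ht (m & n & ->). apply T in Hs, Ht.
    destruct (cell_no_period A h (floors p) s m n) as [-> ->]; auto.
    rewrite shift_0. auto. }
  split; [|split; [exact Inj|]].
  - intro x. split.
    + intros [Cx S]. apply same_chamber_iff in S; auto. destruct S as (_ & m & n & O).
      exists (shift x m n). split; [apply T; auto|]. apply torus_eq_sym. exists m, n. auto.
    + intros (t & Ht & E). apply T in Ht. apply torus_eq_sym in E. destruct E as (m & n & ->).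
      assert (Q := shifted_floors A (floors p) x m n ok Ht). destruct Q as [Cx _].
      split; auto. apply same_chamber_iff; auto. split; auto. exists m, n. auto.
  (* Continuity of the inverse: a translate of [t] close to [s] falls into the same cell as [t], so
     injectivity makes it equal to [t]. *)
  - intros s Hs eps He. assert (Os := proj2 (T s) Hs).
    destruct (open_cell_ball _ _ _ Os) as (e & He' & B).
    exists (Rmin e eps). assert (Hm : 0 < Rmin e eps) by (apply Rmin_glb_lt; auto).
    pose proof (Rmin_l e eps). pose proof (Rmin_r e eps).
    split; auto. intros t Ht (m & n & D).
    assert (Q : open_cell A (floors p) (shift t m n)) by (apply B; nra).
    assert (E : t = shift t m n).
    { apply Inj; auto; [apply T; auto|]. exists m, n. auto. }
    rewrite <- E in D. nra.
Qed.

(** The triangle avoids all lines, so it stays in one cell [k]. It fills this cell: every point of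
    the cell is a translate of a triangle point, and a cell contains no two translates of one
    point. *)
Lemma toric_triangle_cell (A : list tline) (h p : pt) :
  lines_ok A -> spanning A -> generic A h -> compl A p -> toric_triangle (chamber A p) ->
  exists m n P1 P2 P3, noncollinear P1 P2 P3 /\
    forall x, open_cell A (kshift (floors p) m n) x <-> open_triangle P1 P2 P3 x.
Proof.
  intros ok sp G C (P1 & P2 & P3 & N & H & _ & _). cbv zeta in H.
  destruct (triangle_centroid P1 P2 P3) as [t0 H0].
  assert (Ch : forall t, open_triangle P1 P2 P3 t -> chamber A p t).
  { intros t Ht. apply H. exists t. split; auto. apply torus_eq_refl. }
  destruct (proj1 (same_chamber_iff A p t0 ok) (proj2 (Ch t0 H0))) as (_ & m0 & n0 & O0).
  set (k := kshift (floors p) (- m0) (- n0)).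
  assert (K0 : open_cell A k t0).
  { unfold k. rewrite <- (shift_opp t0 m0 n0). apply open_cell_shift. auto. }
  assert (TK : forall t, open_triangle P1 P2 P3 t -> open_cell A k t).
  { intros t Ht l Hl.
    assert (Seg : forall s, 0 <= s <= 1 -> ~ is_int (lval l (vadd t0 s (vsub t t0)))).
    { intros s Hs. apply (proj1 (compl_iff A _ ok)); auto. apply (Ch (vadd t0 s (vsub t t0))).
      apply open_triangle_bary; auto. apply open_triangle_bary in H0, Ht; auto.
      rewrite !bary_affine. repeat split; nra. }
    specialize (K0 l Hl). rewrite <- (vadd_vsub t0 t), lval_vadd, ldir_vsub.
    set (x := lval l t0) in *. set (y := lval l t) in *.
    (* Intermediate value: leaving the strip would cross a line at the parameter (z - x) / (y - x)
       of a segment inside the triangle. *)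
    assert (Mid : forall z, (x < IZR z <= y \/ y <= IZR z < x) -> False).
    { intros z Hz. assert (Nxy : y - x <> 0) by lra.
      apply (Seg ((IZR z - x) / (y - x))).
      - assert (E : (IZR z - x) / (y - x) * (y - x) = IZR z - x) by (field; auto).
        set (s := (IZR z - x) / (y - x)) in *. clearbody s. split; apply Rnot_lt_le; intro; nra.
      - exists z. rewrite lval_vadd, ldir_vsub. fold x y. field. auto. }
    split; apply Rnot_le_lt; intro L.
    - apply (Mid (k l)). lra.
    - apply (Mid (k l + 1)%Z). rewrite plus_IZR. lra. }
  exists (- m0)%Z, (- n0)%Z, P1, P2, P3. split; auto. fold k. intro x. split; auto.
  intro O.
  assert (Cx : chamber A p x).
  { assert (Ox : open_cell A (floors p) (shift x m0 n0)).
    { apply (open_cell_ext A (kshift k m0 n0)); [|apply open_cell_shift; auto].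
      intros l _. unfold k. apply kshift_opp. }
    split; [apply (open_cell_compl A k); auto|].
    apply same_chamber_iff; auto. split; auto. exists m0, n0. auto. }
  apply H in Cx. destruct Cx as (t & Ht & m & n & ->).
  destruct (cell_no_period A h k t m n ok sp G (TK t Ht) O) as [-> ->].
  rewrite shift_0. auto.
Qed.

(** Under equality no two pairs can see the same chamber, so a cell has no second middle vertex and
    [v0], [w], [v1] are all its vertices. *)
Lemma chambers_le_twice_vertices (A : list tline) (f0 f2 : nat) :
  arrangement A -> num_vertices A f0 -> num_chambers A f2 ->
  (f2 <= 2 * f0)%nat /\ (f2 = (2 * f0)%nat -> simplicial A).
Proof.
  intros ar HV HC. assert (ok := arrangement_lines_ok A ar).
  assert (sp := arrangement_spanning A ar). destruct (generic_exists A ok) as [h G].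
  assert (Nh := generic_nonzero A h sp G).
  destruct (num_vertices_reps A f0 ar HV) as (lv & Lv & NDv & Pv & Uv & Tv).
  destruct (num_chambers_reps A f2 ok HC) as (lc & Lc & NDc & Pc & Uc & Tc).
  set (ly := list_prod lv (true :: false :: nil)).
  assert (Ly : length ly = (2 * f0)%nat) by (unfold ly; rewrite list_prod_bool_length, Lv; auto).
  assert (Iy : forall v b, In v lv -> In (v, b) ly).
  { intros v b Hv. apply in_prod; auto. destruct b; simpl; auto. }
  assert (T : forall c, In c lc -> exists x, In x ly /\ beside A h c x).
  { intros c Hc. destruct (beside_exists A h c ok sp G (Pc c Hc)) as (w & b & X & Ge).
    destruct (Tv w X) as (v & Hv & E). exists (v, b). split; auto.
    apply (beside_torus_eq A h v w); [apply torus_eq_sym; auto|].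
    exists 0%Z, 0%Z. rewrite shift_0. auto. }
  assert (U : forall c c' x, In c lc -> In c' lc -> beside A h c x -> beside A h c' x -> c = c').
  { intros c c' x Hc Hc' B B'. apply Uc; auto.
    apply (beside_same_chamber A h c c' x); auto. }
  split.
  - rewrite <- Ly, <- Lc. apply (pigeonhole_rel lc ly (beside A h)); auto.
  - intros Eq p C. assert (O := open_cell_floors A p ok C).
    destruct (cell_tops_exist A h _ p ok sp G O) as (v0 & v1 & T1 & T0).
    destruct (middle_vertex_exists A h _ v0 v1 p ok sp G O T1 T0) as (w & X & Cw & N0 & N1).
    destruct (middle_vertex_germ A h _ v0 v1 w sp G T1 T0 X Cw N0 N1) as [[b Gb] NC].
    apply (toric_triangle_of_cell A h p v0 w v1); auto.
    apply cell_triangle; auto.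
    { apply T0. }
    { apply T1. }
    intros w' Cw' X'.
    destruct (classic (w' = v0)) as [E0|N0']; auto.
    destruct (classic (w' = v1)) as [E1|N1']; auto.
    destruct (classic (w' = w)) as [E|Nw]; auto. exfalso.
    destruct (middle_vertex_germ A h _ v0 v1 w' sp G T1 T0 X' Cw' N0' N1') as [[b' Gb'] _].
    destruct (chamber_rep A lc _ p ok Tc O) as (c & m & n & Hc & E).
    destruct (Tv w X) as (v & Hv & Ev). destruct (Tv w' X') as (v' & Hv' & Ev').
    assert (B : beside A h c (v, b)).
    { apply (beside_torus_eq A h v w); [apply torus_eq_sym; auto|].
      exists (- m)%Z, (- n)%Z. apply (germ_unshift A (floors p)); auto. }
    assert (B' : beside A h c (v', b')).
    { apply (beside_torus_eq A h v' w'); [apply torus_eq_sym; auto|].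
      exists (- m)%Z, (- n)%Z. apply (germ_unshift A (floors p)); auto. }
    (* Distinct middle vertices of the cell might be lifts of one torus vertex. With the same side
       their germs would then be translates of each other, giving the cell a period. *)
    assert (NE : (v', b') <> (v, b)).
    { intro Z. injection Z as Zv Zb. subst v' b'. apply torus_eq_sym in Ev'.
      destruct Ev as (m1 & n1 & ->). destruct Ev' as (m2 & n2 & ->).
      rewrite shift_shift in *.
      apply (germ_shift A _ _ _ (m1 + m2) (n1 + n2)) in Gb.
      assert (K := germ_unique A _ _ _ _ Gb' Gb).
      destruct (cell_no_period A h (floors p) p (m1 + m2) (n1 + n2)) as [E1 E2]; auto.
      { apply (open_cell_ext A (kshift (floors p) (m1 + m2) (n1 + n2)));
          [intros; symmetry; auto|]. apply open_cell_shift.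
        exact O. }
      apply Nw. rewrite E1, E2, shift_0. auto. }
    (* [(v, b)] is a redundant target: the only listed chamber beside it is [c], which is also
       beside [(v', b')]. *)
    assert (length lc < length ly)%nat; [|lia].
    apply (pigeonhole_rel_strict lc ly (beside A h) (v', b') (v, b)); auto.
    intros c' Hc' Bc'. rewrite (U c' c (v, b)); auto.
Qed.

Lemma simplicial_chambers (A : list tline) (f0 f2 : nat) :
  arrangement A -> num_vertices A f0 -> num_chambers A f2 -> simplicial A -> (2 * f0 <= f2)%nat.
Proof.
  intros ar HV HC S. assert (ok := arrangement_lines_ok A ar).
  assert (sp := arrangement_spanning A ar). destruct (generic_exists A ok) as [h G].
  assert (Nh := generic_nonzero A h sp G).
  destruct (num_vertices_reps A f0 ar HV) as (lv & Lv & NDv & Pv & Uv & Tv).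
  destruct (num_chambers_reps A f2 ok HC) as (lc & Lc & NDc & Pc & Uc & Tc).
  rewrite <- Lc, <- Lv, <- list_prod_bool_length.
  assert (Gs : forall b, generic A (side b h))
    by (intros [|]; [exact G|apply generic_vopp; exact G]).
  (* a triangle has only one vertex besides its highest and lowest ones *)
  assert (One : forall c w w' b b', compl A c -> crossing A w -> crossing A w' ->
    germ A (floors c) w (side b h) -> germ A (floors c) w' (side b' h) -> w = w').
  { intros c w w' b b' C X X' Ge Ge'.
    destruct (toric_triangle_cell A h c ok sp G C (S c C)) as (m & n & P1 & P2 & P3 & N & H).
    set (k := kshift (floors c) m n) in *.
    apply (germ_shift A _ _ _ m n) in Ge, Ge'. fold k in Ge, Ge'.
    apply (crossing_shift A _ m n) in X, X'.
    apply (shift_inj w w' m n).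
    set (z := shift w m n) in *. set (z' := shift w' m n) in *. clearbody z z'.
    assert (V := triangle_cell_vertices A k P1 P2 P3 N H).
    destruct (germ_point _ _ _ _ Ge) as (t & _ & O).
    destruct (cell_tops_exist A h k _ ok sp G O) as (v0 & v1 & T1 & T0).
    assert (Cz := V z (germ_closed _ _ _ _ Ge) X).
    assert (Cz' := V z' (germ_closed _ _ _ _ Ge') X').
    assert (C0 := V v0 (proj1 T0) (proj1 (proj2 T0))).
    assert (C1 := V v1 (proj1 T1) (proj1 (proj2 T1))).
    assert (M : forall y d, germ A k y (side d h) -> y <> v0 /\ y <> v1).
    { intros y d Gy. split; apply (side_germ_not_top A h k y _ d); auto. }
    destruct (M z b Ge) as [A0 A1]. destruct (M z' b' Ge') as [A0' A1'].
    assert (N01 : v0 <> v1).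
    { intros <-. destruct T0 as (K0 & _ & M0). destruct T1 as (_ & _ & M1).
      assert (L0 := M0 z (germ_closed _ _ _ _ Ge) A0).
      assert (L1 := M1 z (germ_closed _ _ _ _ Ge) A0). rewrite !cross_vopp in L0. lra. }
    (* The lowest and highest vertices occupy two of the three corners, so [z] and [z'] share the
       third. *)
    destruct C0 as [->|[->| ->]], C1 as [->|[->| ->]], Cz as [->|[->| ->]],
      Cz' as [->|[->| ->]]; congruence. }
  (* The relation carries [compl A c] because the injectivity clause does not provide that [c] is
     listed. *)
  apply (pigeonhole_rel _ lc (fun x c => compl A c /\ beside A h c x)).
  - apply NoDup_prod; auto. constructor; [intros [E|[]]; discriminate|].
    constructor; [intros []|constructor].
  - intros [w b] Hx. apply in_prod_iff in Hx as [Hw _].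
    assert (Ge : germ A (germ_floors w (side b h)) w (side b h)).
    { apply germ_exists. intros l Hl _. apply Gs; auto. }
    destruct (germ_point _ _ _ _ Ge) as (t & _ & O).
    destruct (chamber_rep A lc _ _ ok Tc O) as (c & m & n & Hc & E).
    exists c. split; auto. split; auto. exists (- m)%Z, (- n)%Z. simpl.
    apply (germ_unshift A (germ_floors w (side b h))); auto.
  - intros [w b] [w' b'] c Hx Hx' [C (m & n & Ge)] [_ (m' & n' & Ge')]. simpl in *.
    apply in_prod_iff in Hx as [Hw _]. apply in_prod_iff in Hx' as [Hw' _].
    assert (X := crossing_shift A w m n (Pv w Hw)).
    assert (X' := crossing_shift A w' m' n' (Pv w' Hw')).
    assert (E := One c _ _ b b' C X X' Ge Ge').
    assert (Ew : w = w').
    { apply Uv; auto. exists (m + - m')%Z, (n + - n')%Z.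
      rewrite <- shift_shift, E, shift_opp. reflexivity. }
    rewrite <- E in Ge'. f_equal; auto.
    (* If one cell were seen from the vertex in both directions, the vertex would be interior to a
       level segment of the closed cell; extremity would give [h = (0, 0)]. *)
    destruct (Bool.bool_dec b b') as [Eb|Nb]; auto. exfalso.
    apply Nh.
    destruct (germ_point _ _ _ _ Ge) as (t & Ht & O).
    destruct (germ_point _ _ _ _ Ge') as (t' & Ht' & O').
    assert (Op : forall y s, vadd y s (vopp h) = vadd y (- s) h)
      by (intros; unfold vadd, vopp; simpl; f_equal; ring).
    apply open_closed_cell in O, O'. apply germ_closed in Ge.
    destruct b, b'; try congruence; simpl in *; rewrite Op in *.
    + apply (crossing_extreme A (floors c) (shift w m n) h t t'); auto.
    + apply (crossing_extreme A (floors c) (shift w m n) h t' t); auto.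
Qed.

(** * Arrangements realising all pairs *)

Lemma card_classes_map {X : Type} (idx : list X) (rep : X -> pt)
    (P : pt -> Prop) (E : pt -> pt -> Prop) :
  NoDup idx -> (forall a, In a idx -> P (rep a)) ->
  (forall a b, In a idx -> In b idx -> E (rep a) (rep b) -> a = b) ->
  (forall x, P x -> exists a, In a idx /\ E x (rep a)) ->
  card_classes P E (length idx).
Proof.
  intros ND HP U T. exists (map rep idx). split; [apply length_map|]. split; [|split].
  - intros x Hx. apply in_map_iff in Hx as (a & <- & Ha). auto.
  - intros i j Hij Hj HE. destruct idx as [|d idx']; [simpl in Hj; lia|].
    set (idx := d :: idx') in *.
    rewrite (nth_indep _ (0, 0) (rep d)) in HE by (rewrite length_map; lia).
    rewrite (nth_indep (map rep idx) (0, 0) (rep d) (n := j)) in HE by (rewrite length_map; lia).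
    rewrite !map_nth in HE.
    assert (i = j); [|lia].
    apply (proj1 (NoDup_nth idx d) ND); try lia.
    apply U; auto; apply nth_In; lia.
  - intros x Hx. destruct (T x Hx) as (a & Ha & HE). exists (rep a). split; auto.
    apply in_map. auto.
Qed.

Definition fan_line (n j : nat) : tline := (1%Z, 0%Z, INR j / INR n).

(* The lines y = 0 and y = n x meet in the n points (i/n, 0); the lines x = j/n with
   j < t make t of them triple points. *)
Definition fan (n t : nat) : list tline :=
  (0%Z, 1%Z, 0) :: (Z.of_nat n, (-1)%Z, 0) :: map (fan_line n) (seq 0 t).

Lemma in_fan (n t : nat) (l : tline) :
  In l (fan n t) <-> l = (0%Z, 1%Z, 0) \/ l = (Z.of_nat n, (-1)%Z, 0) \/
    exists j, (j < t)%nat /\ l = fan_line n j.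
Proof.
  unfold fan. simpl. rewrite in_map_iff. split.
  - intros [<-|[<-|(j & <- & Hj)]]; auto. right; right. exists j.
    apply in_seq in Hj. split; auto; lia.
  - intros [->|[->|(j & Hj & ->)]]; auto. right; right. exists j.
    split; auto. apply in_seq. lia.
Qed.

Lemma fan_lines_ok (n t : nat) : lines_ok (fan n t).
Proof.
  intros l Hl. apply in_fan in Hl as [->|[->|(j & _ & ->)]]; simpl; auto.
  rewrite Z.gcd_comm, Z.gcd_opp_l with (n := 1%Z). apply Z.gcd_1_l.
Qed.

Lemma is_int_div_small (a : Z) (n : nat) :
  (0 < n)%nat -> (- Z.of_nat n < a < Z.of_nat n)%Z -> is_int (IZR a / INR n) -> a = 0%Z.
Proof.
  intros Hn Ha [z Hz]. rewrite INR_IZR_INZ in Hz.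
  assert (Pn : IZR (Z.of_nat n) <> 0) by (apply not_0_IZR; lia).
  assert (E : IZR a = IZR (z * Z.of_nat n)).
  { rewrite mult_IZR, <- Hz. field. auto. }
  apply eq_IZR in E. assert (z = 0 \/ z <= -1 \/ 1 <= z)%Z as [->|[Lz|Lz]] by lia; nia.
Qed.

Lemma fan_line_inj (n i j : nat) :
  (i < n)%nat -> (j < n)%nat -> same_tline (fan_line n i) (fan_line n j) -> i = j.
Proof.
  intros Hi Hj S.
  assert (ok : forall m, tline_ok (fan_line n m)) by (intro; reflexivity).
  assert (H : is_int (lval (fan_line n j) (INR i / INR n, 0))).
  { apply on_tline_iff; auto. apply S. apply on_tline_iff; auto. exists 0%Z. simpl. ring. }
  assert (Z : (Z.of_nat i - Z.of_nat j = 0)%Z); [|lia].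
  apply (is_int_div_small _ n); try lia.
  destruct H as [z Hz]. exists z. rewrite <- Hz. simpl.
  rewrite minus_IZR, <- !INR_IZR_INZ. unfold Rdiv. ring.
Qed.

Lemma fan_arrangement (n t : nat) : (0 < n)%nat -> (t <= n)%nat -> arrangement (fan n t).
Proof.
  intros Hn Ht. assert (ok := fan_lines_ok n t). split; [exact ok|]. split.
  - assert (U : forall l l', In l (fan n t) -> In l' (fan n t) -> same_tline l l' -> l = l').
    { intros l l' Hl Hl' S. assert (D := same_tline_parallel l l' (ok l Hl) (ok l' Hl') S).
      apply in_fan in Hl, Hl'.
      destruct Hl as [->|[->|(i & Hi & ->)]], Hl' as [->|[->|(j & Hj & ->)]];
        try reflexivity; try (exfalso; unfold ldet, fan_line in D; lia).
      rewrite (fan_line_inj n i j) by (auto; lia). reflexivity. }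
    assert (ND : NoDup (fan n t)).
    { unfold fan. constructor; [|constructor].
      - intros [E|H]; [injection E; lia|]. apply in_map_iff in H as (j & E & _).
        discriminate E.
      - intro H. apply in_map_iff in H as (j & E & _). injection E; lia.
      - apply NoDup_map_NoDup_ForallPairs; [|apply seq_NoDup].
        intros i j Hi Hj E. apply in_seq in Hi, Hj.
        apply (fan_line_inj n i j); try lia. rewrite E. intro p. tauto. }
    intros i j Hi Hj N S. apply N.
    apply (proj1 (NoDup_nth _ (0%Z, 0%Z, 0)) ND); auto.
    apply U; auto; apply nth_In; auto.
  - intros (a & b & Gab & H).
    destruct (H (0%Z, 1%Z, 0)) as [c S]; [apply in_fan; auto|].
    destruct (H (Z.of_nat n, (-1)%Z, 0)) as [c' S']; [apply in_fan; auto|].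
    apply same_tline_parallel in S; [|reflexivity|exact Gab].
    apply same_tline_parallel in S';
      [|apply (ok (Z.of_nat n, (-1)%Z, 0)); apply in_fan; auto|exact Gab].
    unfold ldet in S, S'. assert (a = 0%Z) by lia. assert (b = 0%Z) by nia.
    subst. discriminate.
Qed.

(** Integrality of two of [y], [n x - y] and [n x] implies that of the third, so every crossing
    already lies on both [y = 0] and [y = n x]: the vertical lines add no vertex. *)
Lemma fan_crossing (n t : nat) (x y : R) :
  (0 < n)%nat -> crossing (fan n t) (x, y) -> is_int y /\ is_int (INR n * x).
Proof.
  intros Hn (l1 & l2 & H1 & H2 & D & I1 & I2).
  assert (Pn : 0 < INR n) by (apply lt_0_INR; auto).
  assert (C1 : is_int (lval (0%Z, 1%Z, 0) (x, y)) -> is_int y).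
  { intros [z Hz]. exists z. simpl in Hz. lra. }
  assert (C2 : is_int (lval (Z.of_nat n, (-1)%Z, 0) (x, y)) -> is_int (INR n * x - y)).
  { intros [z Hz]. exists z. simpl in Hz. rewrite <- INR_IZR_INZ in Hz. lra. }
  assert (C3 : forall j, is_int (lval (fan_line n j) (x, y)) -> is_int (INR n * x)).
  { intros j [z Hz]. exists (Z.of_nat n * z + Z.of_nat j)%Z. simpl in Hz.
    rewrite plus_IZR, mult_IZR, <- !INR_IZR_INZ, <- Hz. field. lra. }
  assert (S1 : is_int y -> is_int (INR n * x - y) -> is_int (INR n * x)).
  { intros [z Hz] [z' Hz']. exists (z + z')%Z. rewrite plus_IZR. lra. }
  assert (S2 : is_int (INR n * x) -> is_int (INR n * x - y) -> is_int y).
  { intros [z Hz] [z' Hz']. exists (z - z')%Z. rewrite minus_IZR. lra. }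
  apply in_fan in H1, H2.
  destruct H1 as [->|[->|(i & Hi & ->)]], H2 as [->|[->|(j & Hj & ->)]];
    try (exfalso; apply D; unfold ldet, fan_line; lia); split; eauto.
Qed.

Lemma fan_num_vertices (n t : nat) :
  (0 < n)%nat -> (t <= n)%nat -> num_vertices (fan n t) n.
Proof.
  intros Hn Ht. assert (ar := fan_arrangement n t Hn Ht).
  assert (Pn : 0 < INR n) by (apply lt_0_INR; auto).
  unfold num_vertices. rewrite <- (length_seq n 0) at 2.
  apply (card_classes_map (seq 0 n) (fun i => (INR i / INR n, 0))).
  - apply seq_NoDup.
  - intros i Hi. apply vertex_iff; auto.
    exists (0%Z, 1%Z, 0), (Z.of_nat n, (-1)%Z, 0).
    split; [apply in_fan; auto|]. split; [apply in_fan; auto|].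
    split; [unfold ldet; lia|]. split; [exists 0%Z; simpl; ring|].
    exists (Z.of_nat i). simpl. rewrite <- !INR_IZR_INZ. field. lra.
  - intros i j Hi Hj (m & m' & E). apply in_seq in Hi, Hj.
    unfold shift in E; simpl in E. injection E as E _.
    assert (Z : (Z.of_nat j - Z.of_nat i = 0)%Z); [|lia].
    apply (is_int_div_small _ n); try lia. exists m.
    rewrite minus_IZR, <- !INR_IZR_INZ. unfold Rdiv in *. lra.
  - intros [x y] V. apply vertex_iff in V; auto.
    destruct (fan_crossing n t x y Hn V) as [[zy Hy] [q Hq]].
    (* The abscissa is q / n; the residue of [q] modulo [n] names the vertex and the quotient is the
       translation. *)
    assert (B := Z.mod_pos_bound q (Z.of_nat n) ltac:(lia)).
    assert (D := Z.div_mod q (Z.of_nat n) ltac:(lia)).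
    exists (Z.to_nat (q mod Z.of_nat n)). split; [apply in_seq; lia|].
    exists (- (q / Z.of_nat n))%Z, (- zy)%Z. unfold shift; simpl.
    rewrite !opp_IZR, Hy. f_equal; [|ring].
    rewrite (INR_IZR_INZ (Z.to_nat _)), Z2Nat.id by lia.
    replace x with (IZR q / INR n) by (rewrite <- Hq; field; lra).
    rewrite D at 2. rewrite plus_IZR, mult_IZR, <- INR_IZR_INZ. field. lra.
Qed.

(** At height 1/2 the parallelogram i - 1 < n x - y < i, 0 < y < 1 is the interval i - 1/2 < n x < i
    + 1/2, bisected by n x = i. The offsets 1/4 and -1/4 pick the midpoints of its right half
    ([true]) and left half ([false]). *)
Definition fan_point (n : nat) (x : nat * bool) : pt :=
  ((INR (fst x) + (if snd x then / 4 else - / 4)) / INR n, / 2).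

(** For [i >= t] the parallelogram is uncut and [(i, false)] alone stands for it. *)
Definition fan_index (n t : nat) : list (nat * bool) :=
  map (fun i => (i, false)) (seq 0 n) ++ map (fun i => (i, true)) (seq 0 t).

Lemma in_fan_index (n t i : nat) (b : bool) :
  (t <= n)%nat -> (In (i, b) (fan_index n t) <-> (i < n)%nat /\ (b = true -> (i < t)%nat)).
Proof.
  intro Ht. unfold fan_index. rewrite in_app_iff, !in_map_iff. split.
  - intros [(j & E & Hj)|(j & E & Hj)]; injection E as <- <-; apply in_seq in Hj;
      split; intros; try discriminate; lia.
  - intros [Hi Hb]. destruct b.
    + right. exists i. split; auto. apply in_seq. specialize (Hb eq_refl). lia.
    + left. exists i. split; auto. apply in_seq. lia.
Qed.

Lemma strip_div (z r N : R) : 0 < N -> z * N < r < z * N + N -> z < r / N < z + 1.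
Proof.
  intros HN [H1 H2]. assert (E : r / N * N = r) by (field; lra).
  set (s := r / N) in *. clearbody s. split; apply Rnot_le_lt; intro; nra.
Qed.

(** In the parallelogram [n x] stays between i - 1 and i + 1, so line [i] is the only vertical line
    that can cut it; the strips of the others are constant. *)
Lemma fan_cell (n t i : nat) (b : bool) :
  (0 < n)%nat -> (t <= n)%nat -> (i < n)%nat ->
  exists k, k (0%Z, 1%Z, 0) = 0%Z /\ k (Z.of_nat n, (-1)%Z, 0) = (Z.of_nat i - 1)%Z /\
    k (fan_line n i) = (if b then 0 else -1)%Z /\
    forall x y, 0 < y < 1 -> INR i - 1 < INR n * x - y < INR i ->
      ((i < t)%nat -> if b then INR i < INR n * x else INR n * x < INR i) ->
      open_cell (fan n t) k (x, y).
Proof.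
  intros Hn Ht Hi. assert (Pn : 1 <= INR n) by (apply (le_INR 1); auto).
  set (P := fan_point n (i, b)).
  exists (floors P).
  assert (Fl : forall z r, IZR z < r < IZR z + 1 -> Int_part r = z).
  { intros z r Hr. apply (IZR_strip_unique r); auto. apply Int_part_strict.
    intros [w ->]. apply (IZR_strict_between z w); lra. }
  assert (E1 : floors P (0%Z, 1%Z, 0) = 0%Z).
  { apply Fl. simpl. lra. }
  assert (E2 : floors P (Z.of_nat n, (-1)%Z, 0) = (Z.of_nat i - 1)%Z).
  { apply Fl. unfold P, fan_point. simpl lval. simpl fst; simpl snd.
    rewrite minus_IZR, <- !INR_IZR_INZ.
    replace (INR n * ((INR i + (if b then / 4 else - / 4)) / INR n) + -1 * / 2 - 0)
      with (INR i + (if b then / 4 else - / 4) - / 2) by (field; lra).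
    destruct b; lra. }
  assert (LP : forall j x y, lval (fan_line n j) (x, y) = (INR n * x - INR j) / INR n).
  { intros. simpl. field. lra. }
  assert (E3 : forall j z, IZR z * INR n < INR i + (if b then / 4 else - / 4) - INR j
      < IZR z * INR n + INR n -> floors P (fan_line n j) = z).
  { intros j z Hz. apply Fl. unfold P, fan_point. rewrite LP. cbn [fst snd].
    apply strip_div; [lra|].
    replace (INR n * ((INR i + (if b then / 4 else - / 4)) / INR n))
      with (INR i + (if b then / 4 else - / 4)) by (field; lra). auto. }
  split; auto. split; auto. split.
  { apply E3. destruct b; simpl; lra. }
  intros x y Hy Hxy Hs l Hl. apply in_fan in Hl as [->|[->|(j & Hj & ->)]].
  - rewrite E1. simpl. lra.
  - rewrite E2. simpl. rewrite minus_IZR, <- !INR_IZR_INZ. lra.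
  - rewrite LP. pose proof (pos_INR i). pose proof (pos_INR j).
    assert (INR i + 1 <= INR n) by (rewrite <- S_INR; apply le_INR; lia).
    assert (INR j + 1 <= INR n) by (rewrite <- S_INR; apply le_INR; lia).
    destruct (Nat.lt_trichotomy j i) as [L|[->|L]].
    + assert (INR j + 1 <= INR i) by (rewrite <- S_INR; apply le_INR; lia).
      rewrite (E3 j 0%Z) by (destruct b; simpl; lra). apply strip_div; lra.
    + specialize (Hs Hj).
      rewrite (E3 i (if b then 0 else -1)%Z) by (destruct b; simpl; lra).
      destruct b; apply strip_div; simpl; lra.
    + assert (INR i + 1 <= INR j) by (rewrite <- S_INR; apply le_INR; lia).
      rewrite (E3 j (-1)%Z) by (destruct b; simpl; lra). apply strip_div; lra.
Qed.

Lemma fan_point_cell (n i : nat) (b : bool) :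
  (0 < n)%nat -> let P := fan_point n (i, b) in
  0 < snd P < 1 /\ INR i - 1 < INR n * fst P - snd P < INR i /\
  (if b then INR i < INR n * fst P else INR n * fst P < INR i).
Proof.
  intros Hn. assert (Pn : 1 <= INR n) by (apply (le_INR 1); auto).
  cbv zeta. unfold fan_point. cbn [fst snd].
  replace (INR n * ((INR i + (if b then / 4 else - / 4)) / INR n))
    with (INR i + (if b then / 4 else - / 4)) by (field; lra).
  destruct b; repeat split; lra.
Qed.

Lemma fan_num_chambers (n t : nat) :
  (0 < n)%nat -> (t <= n)%nat -> num_chambers (fan n t) (n + t).
Proof.
  intros Hn Ht. assert (ok := fan_lines_ok n t).
  assert (Pn : 1 <= INR n) by (apply (le_INR 1); auto).
  assert (L : length (fan_index n t) = (n + t)%nat)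
    by (unfold fan_index; rewrite length_app, !length_map, !length_seq; auto).
  assert (In1 : In (0%Z, 1%Z, 0) (fan n t)) by (apply in_fan; auto).
  assert (In2 : In (Z.of_nat n, (-1)%Z, 0) (fan n t)) by (apply in_fan; auto).
  assert (Cell : forall i (b : bool), (i < n)%nat -> exists k,
    k (0%Z, 1%Z, 0) = 0%Z /\ k (Z.of_nat n, (-1)%Z, 0) = (Z.of_nat i - 1)%Z /\
    k (fan_line n i) = (if b then 0 else -1)%Z /\
    open_cell (fan n t) k (fan_point n (i, b)) /\
    forall x y, 0 < y < 1 -> INR i - 1 < INR n * x - y < INR i ->
      ((i < t)%nat -> if b then INR i < INR n * x else INR n * x < INR i) ->
      open_cell (fan n t) k (x, y)).
  { intros i b Hi. destruct (fan_cell n t i b Hn Ht Hi) as (k & K1 & K2 & K3 & K).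
    exists k. repeat (split; [auto; fail|]). split; auto.
    destruct (fan_point_cell n i b Hn) as (Q1 & Q2 & Q3).
    destruct (fan_point n (i, b)) as [x y]. apply K; auto. }
  unfold num_chambers. rewrite <- L. apply (card_classes_map _ (fan_point n)).
  - apply NoDup_app.
    + apply NoDup_map_NoDup_ForallPairs; [|apply seq_NoDup].
      intros i j _ _ E. injection E; auto.
    + apply NoDup_map_NoDup_ForallPairs; [|apply seq_NoDup].
      intros i j _ _ E. injection E; auto.
    + intros a Ha Hb. apply in_map_iff in Ha as (i & <- & _).
      apply in_map_iff in Hb as (j & E & _). discriminate.
  - intros [i b] Hi. apply in_fan_index in Hi as [Hi _]; auto.
    destruct (Cell i b Hi) as (k & _ & _ & _ & O & _).
    apply (open_cell_compl _ k); auto.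
  - intros [i b] [j c] Ha Hb S. apply in_fan_index in Ha as [Hi Hit]; auto.
    apply in_fan_index in Hb as [Hj Hjt]; auto.
    destruct (Cell i b Hi) as (k & K1 & K2 & K3 & O & _).
    destruct (Cell j c Hj) as (k' & K1' & K2' & K3' & O' & _).
    apply same_chamber_iff in S; auto. destruct S as (C & m & m' & Om).
    assert (E : forall l, In l (fan n t) -> k l = kshift k' m m' l).
    { intros l Hl. transitivity (floors (fan_point n (i, b)) l).
      - apply (open_cell_unique (fan n t) _ _ (fan_point n (i, b))); auto.
        apply open_cell_floors; auto.
      - apply (open_cell_unique (fan n t) _ _ (shift (fan_point n (j, c)) m m')); auto.
        apply open_cell_shift. auto. }
    assert (Z1 := E _ In1). assert (Z2 := E _ In2). unfold kshift in Z1, Z2.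
    rewrite K1, K1' in Z1. rewrite K2, K2' in Z2. cbn [fst snd] in Z1, Z2.
    (* The strip of [y = 0] fixes the vertical translation; as [i] and [j] differ by less than [n],
       the strip of [y = n x] then gives [m = 0] and [i = j]. *)
    assert (Em' : m' = 0%Z) by lia. subst m'.
    assert (Em : m = 0%Z) by nia. subst m.
    assert (Ei : i = j) by lia. subst j. f_equal.
    destruct (Bool.bool_dec b c) as [|Nb]; auto. exfalso.
    (* One of [b], [c] is [true], so the vertical line [i] is present and its strips 0 and -1
       separate the two halves. *)
    assert (Hi' : (i < t)%nat) by (destruct b, c; try congruence; auto).
    assert (Z3 := E (fan_line n i) (proj2 (in_fan n t _)
      (or_intror (or_intror (ex_intro _ i (conj Hi' eq_refl)))))).
    unfold kshift in Z3. rewrite K3, K3' in Z3. destruct b, c; try congruence; lia.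
  - intros [x y] C. assert (C0 := proj1 (compl_iff _ _ ok) C).
    set (q := Int_part y). set (y' := y - IZR q).
    assert (Hy' : 0 < y' < 1).
    { unfold y', q. assert (N : ~ is_int y).
      { intros [z Hz]. apply (C0 _ In1). exists z. simpl. lra. }
      pose proof (Int_part_strict y N). lra. }
    (* [r] is the ceiling of a non-integer; its residue modulo [n] is the index of the parallelogram
       and its quotient [s] the horizontal translation. *)
    set (r := (Int_part (INR n * x - y') + 1)%Z).
    assert (Hr : IZR r - 1 < INR n * x - y' < IZR r).
    { assert (N : ~ is_int (INR n * x - y')).
      { intros [z Hz]. apply (C0 _ In2). exists (z - q)%Z. simpl.
        rewrite minus_IZR, <- INR_IZR_INZ, <- Hz. unfold y'. ring. }
      pose proof (Int_part_strict _ N). unfold r. rewrite plus_IZR. lra. }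
    assert (B := Z.mod_pos_bound r (Z.of_nat n) ltac:(lia)).
    assert (D := Z.div_mod r (Z.of_nat n) ltac:(lia)).
    set (i := Z.to_nat (r mod Z.of_nat n)). set (s := (r / Z.of_nat n)%Z) in *.
    assert (Ei : INR i = IZR r - INR n * IZR s).
    { unfold i. rewrite (INR_IZR_INZ (Z.to_nat _)), Z2Nat.id by lia.
      rewrite D at 2. rewrite plus_IZR, mult_IZR, <- INR_IZR_INZ. ring. }
    assert (Hi : (i < n)%nat) by (unfold i; lia).
    set (x' := x - IZR s).
    assert (Sh : shift (x, y) (- s) (- q) = (x', y')).
    { unfold shift, x', y'. simpl. rewrite !opp_IZR. f_equal; ring. }
    assert (Hx' : INR i - 1 < INR n * x' - y' < INR i) by (unfold x'; lra).
    assert (Hb : exists b, (b = true -> (i < t)%nat) /\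
      ((i < t)%nat -> if b : bool then INR i < INR n * x' else INR n * x' < INR i)).
    { destruct (lt_dec i t) as [Lt|Ge].
      - assert (N : INR n * x' <> INR i).
        { intro E. apply (C0 (fan_line n i)); [apply in_fan; eauto|].
          exists s. simpl. rewrite <- E. unfold x'. field. lra. }
        destruct (Rdichotomy _ _ N); [exists false|exists true]; split; auto; discriminate.
      - exists false. split; [discriminate|]. intro; contradiction. }
    destruct Hb as (b & Hb1 & Hb2).
    destruct (Cell i b Hi) as (k & _ & _ & _ & O & K).
    exists (i, b). split; [apply in_fan_index; auto|].
    apply same_chamber_sym. apply same_chamber_iff; auto.
    split; [apply (open_cell_compl _ k); auto|].
    exists (- s)%Z, (- q)%Z. rewrite Sh. apply (open_cell_ext _ k); [|apply K; auto].
    apply (open_cell_unique _ _ _ (fan_point n (i, b))); auto.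
    apply open_cell_floors; auto. apply (open_cell_compl _ k); auto.
Qed.

Theorem mainTheorem5 :
  (forall f0 f2 : nat, (0 < f0)%nat -> (0 < f2)%nat ->
     ((exists A, arrangement A /\ num_vertices A f0 /\ num_chambers A f2) <->
      (f0 <= f2 <= 2 * f0)%nat)) /\
  (forall (A : list tline) (f0 f2 : nat),
     arrangement A -> num_vertices A f0 -> num_chambers A f2 ->
     ((f2 = f0 <-> simple A) /\ (f2 = 2 * f0 <-> simplicial A))%nat).
Proof.
  split.
  - intros f0 f2 P0 P2. split.
    + intros (A & ar & HV & HC). split.
      * apply (vertices_le_chambers A f0 f2 ar HV HC).
      * apply (chambers_le_twice_vertices A f0 f2 ar HV HC).
    + intros [L1 L2]. exists (fan f0 (f2 - f0)).
      split; [apply fan_arrangement; lia|]. split; [apply fan_num_vertices; lia|].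
      replace f2 with (f0 + (f2 - f0))%nat at 2 by lia.
      apply fan_num_chambers; lia.
  - intros A f0 f2 ar HV HC.
    destruct (vertices_le_chambers A f0 f2 ar HV HC) as [L1 S1].
    destruct (chambers_le_twice_vertices A f0 f2 ar HV HC) as [L2 S2].
    split; split; auto.
    + intro S. pose proof (simple_chambers_le_vertices A f0 f2 ar HV HC S). lia.
    + intro S. pose proof (simplicial_chambers A f0 f2 ar HV HC S). lia.
Qed.
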